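(* Let $D_\circ\subset D'_\circ$ be two hollow dissections, and identify $\mathbb{R}^{D_\circ}$ with the coordinate subspace of $\mathbb{R}^{D'_\circ}$ spanned by $\{\mathbf{e}_{\delta_\circ}:\delta_\circ\in D_\circ\}$. Then the $\mathbf{g}$-vector fan $\mathcal{G}(D_\circ)$ equals $\{C\in\mathcal{G}(D'_\circ) : C\subseteq\mathbb{R}^{D_\circ}\}$, and it also equals the section $\{C\cap\mathbb{R}^{D_\circ} : C\in\mathcal{G}(D'_\circ)\}$.
   Context: Fix $n\ge 2$ and $2n$ points on the unit circle of the (standardly oriented) Euclidean plane, labeled $1,\dots,2n$ in clockwise order (labels modulo $2n$). Odd-labeled points are hollow, even-labeled ones solid. The hollow (resp. solid) polygon is the convex hull of the hollow (resp. solid) points. A hollow (resp. solid) diagonal joins two hollow (resp. two solid) points; polygon edges (boundary edges) count as diagonals, the others are internal. Two segments cross if they meet at a point interior to both. A hollow (resp. solid) dissection is a set of pairwise non-crossing internal hollow (resp. solid) diagonals; its cells are the closures of connected components of the polygon minus its diagonals; $\overline{D}$ is $D$ together with the boundary edges of its polygon. For a hollow dissection $D_\circ$, a solid diagonal $\delta_\bullet$ is a $D_\circ$-accordion diagonal if the union of the segments of $\overline{D_\circ}$ crossed by $\delta_\bullet$ is connected; a $D_\circ$-accordion dissection is a solid dissection made of $D_\circ$-accordion diagonals. Sign function: for a dissection $R$ of one polygon, $r\in R$, and a diagonal $e$ of the other polygon: $\zeta_R(r,e)=0$ if $e$ does not cross $r$; otherwise, in each of the two cells of $R$ containing $r$,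 $e$ crosses exactly one other segment of $\overline{R}$, call them $\mu,\nu$; if they are incident to distinct endpoints of $r$, write $r=uv,\mu=au,\nu=vb$ and set $\zeta_R(r,e)=1$ if $a$ lies strictly right of the directed line $u\to v$, $-1$ if strictly left; otherwise $0$. $\mathbf{g}(D_\circ\mid\delta_\bullet)=\sum_{\delta_\circ\in D_\circ}\zeta_{D_\circ}(\delta_\circ,\delta_\bullet)\mathbf{e}_{\delta_\circ}\in\mathbb{R}^{D_\circ}$, and the $\mathbf{g}$-vector fan is $\mathcal{G}(D_\circ)=\{\mathbb{R}_{\ge0}\{\mathbf{g}(D_\circ\mid\delta_\bullet):\delta_\bullet\in D_\bullet\}: D_\bullet \text{ a } D_\circ\text{-accordion dissection}\}$. *)

(* Defs.v *)
From HB Require Import structures.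
From mathcomp Require Import all_boot all_order all_algebra.
From mathcomp Require Import all_classical all_reals all_analysis.

Set Implicit Arguments.
Unset Strict Implicit.
Unset Printing Implicit Defensive.

Import Order.TTheory GRing.Theory Num.Theory.
Import numFieldNormedType.Exports.

Local Open Scope ring_scope.
Local Open Scope classical_set_scope.

(* The ordinal i : 'I_(n.*2) stands for the point labeled i.+1, so the hollow
   (odd-labeled) points are the even ordinals. *)
Section Labels.
Variable n : nat.
Local Notation pt := 'I_(n.*2).

Definition hollow : {set pt} := [set i : pt | odd i.+1]%SET.
Definition solid : {set pt} := [set i : pt | ~~ odd i.+1]%SET.

(* A segment joining two labeled points is encoded by the set of its two
   endpoints; V is the vertex set of a polygon, either hollow or solid. *)
Definition polygon_diagonal (V d : {set pt}) : bool :=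
  (d \subset V) && (#|d| == 2%N).

(* When n = 2 each polygon degenerates to a segment, which is then its only
   boundary edge. *)
Definition boundary_edge (V d : {set pt}) : bool :=
  polygon_diagonal V d &&
  [exists i : pt, exists j : pt,
     (d == [set i; j]%SET) && (j == i + 2 %[mod n.*2])%N].

Definition internal (V d : {set pt}) : bool :=
  polygon_diagonal V d && ~~ boundary_edge V d.

Definition overline (V : {set pt}) (D : {set {set pt}}) : {set {set pt}} :=
  (D :|: [set d | boundary_edge V d])%SET.

End Labels.

Arguments hollow {n}.
Arguments solid {n}.

(* The space R^D. *)
Notation coords R D := {ffun {d | d \in D} -> R^o}.

(* R^o is R viewed as a module over itself; the topology is the product one. *)
Notation plane R := (R^o * R^o)%type.

Section Plane.
Variable R : realType.

Definition on_unit_circle (x : plane R) : Prop := x.1 ^+ 2 + x.2 ^+ 2 = 1 :> R.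

Definition orient (u v a : plane R) : R :=
  (v.1 - u.1) * (a.2 - u.2) - (v.2 - u.2) * (a.1 - u.1).

Definition right_of (u v a : plane R) : Prop := orient u v a < 0.
Definition left_of (u v a : plane R) : Prop := 0 < orient u v a.

Definition clockwise (m : nat) (p : 'I_m -> plane R) : Prop :=
  forall i j k : 'I_m, (i < j)%N -> (j < k)%N -> right_of (p i) (p j) (p k).

End Plane.

Section GVectorFan.
Variables (R : realType) (n : nat).
Local Notation pt := 'I_(n.*2).
Variable p : pt -> plane R.

Definition hull (A : {set pt}) : set (plane R) :=
  [set x | exists w : pt -> R,
     [/\ forall i, i \in A -> 0 <= w i, \sum_(i in A) w i = 1
       & x = \sum_(i in A) w i *: p i]].

(* For a two-element set d, the segment d without its endpoints. *)
Definition hull_interior (A : {set pt}) : set (plane R) :=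
  [set x | exists w : pt -> R,
     [/\ forall i, i \in A -> 0 < w i, \sum_(i in A) w i = 1
       & x = \sum_(i in A) w i *: p i]].

Definition cross (d e : {set pt}) : Prop :=
  exists x, hull_interior d x /\ hull_interior e x.

Definition dissection (V : {set pt}) (D : {set {set pt}}) : Prop :=
  (forall d, d \in D -> internal V d) /\
  (forall d d', d \in D -> d' \in D -> d != d' -> ~ cross d d').

Definition polygon_minus (V : {set pt}) (D : {set {set pt}}) :
    set (plane R) :=
  hull V `\` [set x | exists2 d, d \in D & hull d x].

Definition cell (V : {set pt}) (D : {set {set pt}}) (C : set (plane R)) :
    Prop :=
  exists2 x, polygon_minus V D x &
    C = closure (connected_component (polygon_minus V D) x).

Definition crosses_in (V : {set pt}) (D : {set {set pt}}) (r e : {set pt})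
    (C : set (plane R)) (s : {set pt}) : Prop :=
  [/\ s \in overline V D, s != r, hull s `<=` C & cross e s].

(* mu = au and nu = vb are the segments crossed by e in the two cells
   containing r = uv. *)
Definition turns (side : plane R -> plane R -> plane R -> Prop)
    (V : {set pt}) (D : {set {set pt}}) (r e : {set pt}) : Prop :=
  cross e r /\
  exists C1 C2 : set (plane R), exists u v a b : pt,
    [/\ cell V D C1 /\ hull r `<=` C1,
        cell V D C2 /\ hull r `<=` C2,
        C1 <> C2,
        r = [set u; v]%SET &
        [/\ crosses_in V D r e C1 [set a; u]%SET,
            crosses_in V D r e C2 [set v; b]%SET &
            side (p u) (p v) (p a)]].

Definition zeta (V : {set pt}) (D : {set {set pt}}) (r e : {set pt}) : R :=
  if `[< turns (@right_of R) V D r e >] then 1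
  else if `[< turns (@left_of R) V D r e >] then -1
  else 0.

Definition accordion_diagonal (D : {set {set pt}}) (e : {set pt}) : Prop :=
  polygon_diagonal solid e /\
  connected [set x | exists2 s, s \in overline hollow D /\ cross e s
                              & hull s x].

Definition accordion_dissection (D E : {set {set pt}}) : Prop :=
  dissection solid E /\ (forall e, e \in E -> accordion_diagonal D e).

Definition gvector (D : {set {set pt}}) (e : {set pt}) : coords R D :=
  [ffun d => zeta hollow D (val d) e].

Definition gcone (D E : {set {set pt}}) : set (coords R D) :=
  [set x | exists2 c : {set pt} -> R, forall e, e \in E -> 0 <= c e
         & x = \sum_(e in E) c e *: gvector D e].
Arguments gcone : clear implicits.

Definition gfan (D : {set {set pt}}) : set (set (coords R D)) :=
  [set C | exists2 E, accordion_dissection D E & C = gcone D E].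
Arguments gfan : clear implicits.

(* The identification of R^D with a coordinate subspace of R^D', for D
   contained in D': extension by zero. *)
Definition embed (D D' : {set {set pt}}) (x : coords R D) : coords R D' :=
  [ffun d' : {d : {set pt} | d \in D'} => oapp x 0 (insub (val d'))].

Definition coord_subspace (D D' : {set {set pt}}) : set (coords R D') :=
  [set x : coords R D' | forall d : {d | d \in D'}, val d \notin D -> x d = 0].

End GVectorFan.

Arguments gcone {R n} p D E _.
Arguments gfan {R n} p D _.
Arguments embed {R n D} D' x.
Arguments coord_subspace {R n} D D' _.

(* Main.v *)
Require Import Defs.
From HB Require Import structures.
From mathcomp Require Import all_boot all_order all_algebra.
From mathcomp Require Import all_classical all_reals all_analysis.
From mathcomp Require Import zify ring lra.

Set Implicit Arguments.
Unset Strict Implicit.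
Unset Printing Implicit Defensive.

Import Order.TTheory GRing.Theory Num.Theory.
Import numFieldNormedType.Exports.

Local Open Scope ring_scope.
Local Open Scope classical_set_scope.

(** Let [e] be a solid diagonal.  The sign [zeta D r e] is nonzero exactly when [D] together with the
    boundary edges contains two segments [au] and [vb], both crossed by [e],
    on different sides of [r = uv]: whenever [e] crosses [uv] and [au], every
    segment of [D] met by [e] in between ends at [u] too, so the neighbours of
    [r] along [e] need not be mentioned ([turnsE]).  In this form the sign is
    visibly monotone in [D].

    If [e] is a [D]-accordion and [r] is a diagonal of a refinement [D'] crossed
    by [e], cutting the connected union along [r] gives two segments of [D],
    one on each side of [r], meeting at an endpoint of [r] (or [r] is one of
    them).  As [e] cannot cross non-crossing segments [uv], [ua], [vb] with [a],
    [b] on the same side of [uv], the signs for [D] and [D'] agree on [D] and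
    vanish on [D' \ D].  Conversely, a diagonal with sign [0] can be removed
    from [D'] without disconnecting the union.  So the [D]-accordions are the
    [D']-accordions whose [g]-vector lies in the coordinate subspace.

    Two accordion diagonals with opposite signs at [r] cross, hence the
    coordinates of the rays of a cone are sign-coherent, and a point of the
    cone lying in the subspace only involves rays lying in the subspace. *)

(** * Cyclic order of labels and combinatorial crossing of chords *)

Section CyclicOrder.
Implicit Types i j k u v w x y a b : nat.

Definition cyc i j k : bool :=
  [|| (i < j < k)%N, (j < k < i)%N | (k < i < j)%N].

(* For labels in clockwise order, [c = true] is the right side of [u -> v]. *)
Definition onside (c : bool) u v w : bool := if c then cyc u v w else cyc v u w.

Definition wside (c : bool) u v w : bool := [|| w == u, w == v | onside c u v w].

(** The combinatorial form of [cross]: [k] and [l] are strictly on opposite sides of [ij], so chords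
    with a common endpoint do not cross. Labels are plain natural numbers here, which lets [lia]
    settle configurations of few points. *)
Definition chord_cross i j k l : bool :=
  (cyc i j k && cyc j i l) || (cyc i j l && cyc j i k).

Lemma cyc_uniq i j k : cyc i j k -> [/\ i != j, j != k & i != k].
Proof. by rewrite /cyc => h; split; lia. Qed.

Lemma chord_crossC i j k l : chord_cross i j k l = chord_cross k l i j.
Proof. rewrite /chord_cross /cyc; lia. Qed.

Lemma chord_cross_swapl i j k l : chord_cross j i k l = chord_cross i j k l.
Proof. rewrite /chord_cross /cyc; lia. Qed.

Lemma chord_cross_swapr i j k l : chord_cross i j l k = chord_cross i j k l.
Proof. rewrite /chord_cross /cyc; lia. Qed.

Lemma onside_swap c u v w : onside c v u w = onside (~~ c) u v w.
Proof. by case: c. Qed.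

Lemma wside_swap c u v w : wside c v u w = wside (~~ c) u v w.
Proof. by rewrite /wside onside_swap orbCA. Qed.

Lemma onsideN c u v w : onside c u v w -> ~~ onside (~~ c) u v w.
Proof. by case: c => /=; rewrite /cyc; lia. Qed.

Lemma onside_total c u v w : u != v -> w != u -> w != v ->
  ~~ onside c u v w -> onside (~~ c) u v w.
Proof. by case: c => /=; rewrite /cyc; lia. Qed.

Lemma onside_uniq c u v w : onside c u v w -> [/\ u != v, w != u & w != v].
Proof. by case: c => /cyc_uniq[? ? ?]; split; rewrite // eq_sym. Qed.

Lemma chord_cross_side c x y u v : chord_cross x y u v ->
  (onside c u v x /\ onside (~~ c) u v y) \/
  (onside c u v y /\ onside (~~ c) u v x).
Proof.
rewrite chord_crossC /chord_cross.
by case: c => /= /orP[]/andP[]; [left|right|right|left].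
Qed.

Lemma noncross_wside c i j u v :
  ~~ chord_cross i j u v -> onside c i j u -> wside c i j v.
Proof. by case: c; rewrite /chord_cross /wside /onside /cyc; lia. Qed.

Lemma wside_both u v w : wside true u v w -> wside false u v w ->
  w = u \/ w = v.
Proof. by rewrite /wside /onside /cyc; lia. Qed.

(** The points [y] and [v] are on the same side of [ua], so [x] must be on the other one, that is,
    between [a] and [u]. *)
Lemma arc_left u v a x y : cyc u v a -> cyc u v x -> cyc v u y ->
  chord_cross x y u a -> cyc u a x.
Proof. rewrite /chord_cross /cyc; lia. Qed.

Lemma arc_right u v b x y : cyc u v b -> cyc u v x -> cyc v u y ->
  chord_cross x y v b -> cyc v x b.
Proof. rewrite /chord_cross /cyc; lia. Qed.

Lemma arcs_cross u v a b x : cyc u v b -> cyc u a x -> cyc v x b -> cyc u v a ->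
  chord_cross u a v b.
Proof. rewrite /chord_cross /cyc; lia. Qed.

(** The endpoint of [xy] on the side of [a] and [b] comes after [a] because [ua] is crossed and
    before [b] because [vb] is. The clockwise order is thus [u], [v], [a], [b], in which [ua] and
    [vb] cross. *)
Lemma fan_conflict_cw x y u v a b :
    chord_cross x y u v -> chord_cross x y u a -> chord_cross x y v b ->
    cyc u v a -> cyc u v b ->
  chord_cross u a v b.
Proof.
move=> hr.
have [[hx hy]|[hy hx]] := chord_cross_side true hr => h1 h2 ha hb.
  exact: arcs_cross hb (arc_left ha hx hy h1) (arc_right hb hx hy h2) ha.
move: h1 h2; rewrite -!(chord_cross_swapl x y) => h1 h2.
exact: arcs_cross hb (arc_left ha hy hx h1) (arc_right hb hy hx h2) ha.
Qed.

Lemma fan_conflict c x y u v a b :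
    chord_cross x y u v -> chord_cross x y u a -> chord_cross x y v b ->
    onside c u v a -> onside c u v b ->
  chord_cross u a v b.
Proof.
case: c => /=; first exact: fan_conflict_cw.
move=> hr h1 h2 ha hb; rewrite chord_crossC.
by apply: (@fan_conflict_cw x y) hb ha; rewrite // chord_cross_swapr.
Qed.

Lemma arcs_order u v a c x x' : cyc u v a -> cyc u v c -> cyc u a x ->
  cyc v x' c -> ~~ chord_cross u a v c -> cyc u x' x.
Proof. rewrite /chord_cross /cyc; lia. Qed.

Lemma chords_cross u v x x' y y' : cyc u v x' -> cyc u x' x -> cyc v u y' ->
  cyc v y' y -> cyc v u y -> chord_cross x y x' y'.
Proof. rewrite /chord_cross /cyc; lia. Qed.

(** On the right of [uv], [x] lies beyond [a] and [x'] before [c]; as [ua] and [vc] do not cross,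
    [x'] precedes [x] clockwise from [v]. The same argument on the left puts [y'] before [y]. The
    order [v], [x'], [x], [u], [y'], [y] makes the two chords cross. *)
Lemma zigzag_cross x y x' y' u v a b c d :
    cyc u v a -> cyc v u b -> cyc u v c -> cyc v u d ->
    chord_cross x y u v -> chord_cross x y u a -> chord_cross x y v b ->
    chord_cross x' y' u v -> chord_cross x' y' v c -> chord_cross x' y' u d ->
    ~~ chord_cross u a v c -> ~~ chord_cross v b u d ->
  chord_cross x y x' y'.
Proof.
move=> ha hb hc hd.
(* Both chords are directed so that they end on the left of [uv]. *)
wlog [hx hy] : x y / cyc u v x /\ cyc v u y.
  move=> H h; have [hxy|[hy hx]] := chord_cross_side true h; first exact: H.
  by move: h; rewrite -!(chord_cross_swapl x y); apply: H.
wlog [hx' hy'] : x' y' / cyc u v x' /\ cyc v u y'.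
  move=> H h h1 h2 h'; have [hxy|[hy' hx']] := chord_cross_side true h'; first exact: H.
  rewrite -(chord_cross_swapr _ _ x' y').
  by move: h h1 h2 h'; rewrite -!(chord_cross_swapl x' y'); apply: H.
move=> _ h1 h2 _ h3 h4 n1 n2.
have ox := arcs_order ha hc (arc_left ha hx hy h1) (arc_right hc hx' hy' h3) n1.
rewrite -chord_cross_swapl in h2; rewrite -chord_cross_swapl in h4.
have oy := arcs_order hb hd (arc_left hb hy hx h2) (arc_right hd hy' hx' h4) n2.
exact: chords_cross hx' ox hy' oy hy.
Qed.

Lemma onside_trans c u i j k :
  onside c u i j -> onside c u j k -> onside c u i k.
Proof. by case: c; rewrite /onside /cyc; lia. Qed.

Lemma chord_cross_base x y u v :
  chord_cross x y u v = (cyc u x v && cyc u v y) || (cyc u y v && cyc u v x).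
Proof. by rewrite /chord_cross /cyc; lia. Qed.

Lemma fan_between_cw x y u v a w :
    chord_cross x y u v -> chord_cross x y u a -> cyc u v w -> cyc u w a ->
  chord_cross x y u w.
Proof.
have tr i j k : cyc u i j -> cyc u j k -> cyc u i k by apply: (@onside_trans true).
rewrite !chord_cross_base => hv ha vw wa.
case/orP: hv => /andP[h1 h2]; case/orP: ha => /andP[h3 h4].
- by rewrite (tr _ _ _ h1 vw) (tr _ _ _ wa h4).
- by move: (tr _ _ _ (tr _ _ _ h4 h1) (tr _ _ _ vw wa)); rewrite /cyc; lia.
- by move: (tr _ _ _ (tr _ _ _ h4 h1) (tr _ _ _ vw wa)); rewrite /cyc; lia.
- by rewrite (tr _ _ _ h1 vw) (tr _ _ _ wa h4) orbT.
Qed.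

(** Read around the circle from [u], one endpoint of [xy] precedes both [v] and [a] and the other
    follows both, so they also lie on either side of [w]. *)
Lemma fan_between c x y u v a w :
    chord_cross x y u v -> chord_cross x y u a ->
    onside c u v w -> onside c u w a ->
  chord_cross x y u w.
Proof.
have rot i j k : cyc i j k = cyc j k i by rewrite /cyc; lia.
case: c => /= hv ha; first exact: fan_between_cw.
by rewrite rot (rot w) => h1 h2; exact: (fan_between_cw ha hv).
Qed.

(** A chord that crosses neither [uv] nor [ua] can enter the triangle [uva] only through its vertex
    [u]; it then ends strictly between [v] and [a]. *)
Lemma triangle_separation c u v a i j :
    i != j -> onside c u v a ->
    ~~ chord_cross i j u v -> ~~ chord_cross i j u a ->
  (exists c', [&& wside c' i j u, wside c' i j v & wside c' i j a]) \/
  (exists w, [/\ (i == u) && (j == w) || (i == w) && (j == u),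
                 onside c u v w & onside c u w a]).
Proof.
have base w : u != w -> onside c u v a ->
    (exists c', (wside c' u w v && wside c' u w a)) \/
    (onside c u v w && onside c u w a).
  move=> uw h.
  case: (boolP (onside c u v w && onside c u w a)); first by right.
  move=> h'; left; case: (boolP (wside c u w v && wside c u w a)) => [|h2].
    by exists c.
  exists (~~ c); move: uw h h' h2; case: c; rewrite /wside /onside /cyc /=; lia.
move=> ij h n1 n2; have [ui|ui] := eqVneq u i.
  rewrite -ui in ij *; case: (base j ij h) => [[c' hc]|/andP[hc hc']].
    by left; exists c'; rewrite {1}/wside eqxx.
  by right; exists j; rewrite !eqxx.
have [uj|uj] := eqVneq u j.
  have iu : u != i by rewrite uj eq_sym.
  rewrite -uj; case: (base i iu h) => [[c' hc]|/andP[hc hc']].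
    by left; exists (~~ c'); rewrite -!(wside_swap c') {1}/wside eqxx.
  by right; exists i; rewrite !eqxx orbT.
have [h'|h'] := boolP (onside true i j u).
  left; exists true; apply/and3P; split; last exact: noncross_wside h'.
    by rewrite /wside h' !orbT.
  exact: noncross_wside h'.
have {}h' := onside_total ij ui uj h'.
left; exists false; apply/and3P; split; last exact: noncross_wside h'.
  by rewrite /wside h' !orbT.
exact: noncross_wside h'.
Qed.

End CyclicOrder.

(** * Parametrised segments, orientation and their continuity *)

Section Segments.
Variable R : realType.
Implicit Types (x y z u v : plane R) (t : R).

Definition seg x y t : plane R := (1 - t) *: x + t *: y.

Lemma seg0 x y : seg x y 0 = x.
Proof. by rewrite /seg subr0 scale1r scale0r addr0. Qed.

Lemma seg1 x y : seg x y 1 = y.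
Proof. by rewrite /seg subrr scale1r scale0r add0r. Qed.

Lemma orient_cycle u v x : orient v x u = orient u v x.
Proof. by rewrite /orient; ring. Qed.

Lemma orient_swap u v x : orient v u x = - orient u v x.
Proof. by rewrite /orient; ring. Qed.

Lemma orient_refl u v : orient u v u = 0 /\ orient u v v = 0.
Proof. by rewrite /orient; split; ring. Qed.

Lemma orient_seg u v x y t :
  orient u v (seg x y t) = (1 - t) * orient u v x + t * orient u v y.
Proof. by rewrite /orient /=; rewrite /GRing.scale /=; ring. Qed.

Lemma seg_continuous x y : continuous (seg x y).
Proof.
move=> t; apply: cvgD; apply: cvgZ; try exact: cvg_cst; last exact: cvg_id.
by apply: cvgB; [exact: cvg_cst|exact: cvg_id].
Qed.

Lemma orient_continuous u v : continuous (orient u v).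
Proof.
move=> x; rewrite /orient; apply: cvgB; apply: cvgM; try exact: cvg_cst.
  by apply: cvgB; [exact: cvg_snd|exact: cvg_cst].
by apply: cvgB; [exact: cvg_fst|exact: cvg_cst].
Qed.

Lemma seg_connected x y : connected (seg x y @` `[0, 1]).
Proof.
apply: connected_continuous_connected; first exact: segment_connected.
apply: continuous_subspaceT; exact: seg_continuous.
Qed.

Lemma seg_closed x y : closed (seg x y @` `[0, 1]).
Proof.
apply: compact_closed; first exact: norm_hausdorff.
apply: continuous_compact; last exact: segment_compact.
apply: continuous_subspaceT; exact: seg_continuous.
Qed.

(** Since [f] has no zero on [B], the conditions [0 < f] and [0 <= f] cut out the same subset of
    [B], which is therefore both open and closed in it. *)
Lemma connected_pos (f : plane R -> R) (B : set (plane R)) z :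
    continuous f -> connected B -> B z -> 0 < f z ->
    (forall y, B y -> f y != 0) ->
  forall y, B y -> 0 < f y.
Proof.
move=> fc Bc Bz fz nz y By.
suff BE : B `&` [set w | 0 < f w] = B by move: By; rewrite -BE => -[].
apply: Bc; first by exists z.
  exists [set w | 0 < f w] => //.
  by apply: (@open_comp _ _ f [set w | 0 < w]) => //; exact: open_gt.
exists [set w | 0 <= f w].
  by apply: (@closed_comp _ _ f [set w | 0 <= w]) => //; exact: closed_ge.
apply/seteqP; split => w [Bw /= fw]; split => //; first exact: ltW.
by rewrite lt_def fw nz.
Qed.

End Segments.

(** * Geometric crossing of chords expressed by the cyclic order *)

Section Chords.
Variables (R : realType) (n : nat) (p : 'I_(n.*2) -> plane R).
Hypothesis hcw : clockwise p.
Local Notation pt := 'I_(n.*2).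
Implicit Types (i j k l : pt) (A d e : {set pt}).

Lemma orient_lt0 i j k : (orient (p i) (p j) (p k) < 0) = cyc i j k.
Proof.
have H (a b c : pt) : cyc a b c -> orient (p a) (p b) (p c) < 0.
  case/or3P => /andP[h1 h2].
  - exact: hcw.
  - by rewrite -orient_cycle; exact: hcw.
  - by rewrite -orient_cycle -orient_cycle; exact: hcw.
apply/idP/idP => [|/H//].
have [|ij] := eqVneq i j.
  by move=> ->; rewrite -orient_cycle (orient_refl _ _).1 ltxx.
have [|ki] := eqVneq k i; first by move=> ->; rewrite (orient_refl _ _).1 ltxx.
have [|kj] := eqVneq k j; first by move=> ->; rewrite (orient_refl _ _).2 ltxx.
move=> lt0; apply: contraLR lt0 => nc; rewrite -leNgt -oppr_le0 -orient_swap.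
by apply: ltW; apply: H; apply: (@onside_total true).
Qed.

Lemma orient_gt0 i j k : (0 < orient (p i) (p j) (p k)) = cyc j i k.
Proof. by rewrite -oppr_lt0 -orient_swap orient_lt0. Qed.

Lemma orient_eq0 i j k : i != j -> orient (p i) (p j) (p k) = 0 -> k = i \/ k = j.
Proof.
move=> ij o0; have [->|ki] := eqVneq k i; first by left.
have [->|kj] := eqVneq k j; first by right.
have := @onside_total true i j k ij ki kj.
by rewrite /= -orient_lt0 -orient_gt0 o0 ltxx => /(_ isT).
Qed.

Lemma orient_neq0 i j k : i != j -> k != i -> k != j ->
  orient (p i) (p j) (p k) != 0.
Proof.
move=> ij ki kj; apply/eqP => /(orient_eq0 ij)[] /eqP; exact/negP.
Qed.

Lemma hull_point A i : i \in A -> hull p A (p i).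
Proof.
move=> iA; exists (fun j => (j == i)%:R); split.
- by move=> j _; rewrite ler0n.
- rewrite (bigD1 i) //= eqxx big1 ?addr0 // => j /andP[_ /negPf->] //.
- rewrite (bigD1 i) //= eqxx scale1r big1 ?addr0 // => j /andP[_ /negPf->].
  by rewrite scale0r.
Qed.

Lemma hull_seg A x y (t : R) : hull p A x -> hull p A y -> 0 <= t <= 1 ->
  hull p A (seg x y t).
Proof.
move=> [w [w0 w1 ->]] [w' [w'0 w'1 ->]] /andP[t0 t1].
exists (fun i => (1 - t) * w i + t * w' i); split.
- by move=> i iA; rewrite addr_ge0 // mulr_ge0 ?subr_ge0 // ?w0 ?w'0.
- by rewrite big_split /= -!mulr_sumr w1 w'1; ring.
- rewrite /seg !scaler_sumr -big_split /=; apply: eq_bigr => i _.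
  by rewrite [RHS]scalerDl !scalerA.
Qed.

Lemma hull_pair i j x : i != j ->
  hull p [set i; j]%SET x <-> (seg (p i) (p j) @` `[0, 1]) x.
Proof.
move=> ij; split=> [[w [w0 w1 ->]]|[t /= tI <-]].
  rewrite !big_setU1 ?inE //= !big_set1 in w1 *.
  exists (w j); first by rewrite /= in_itv /= w0 ?inE ?eqxx ?orbT //=
    -w1 lerDr w0 ?inE ?eqxx.
  by rewrite /seg -w1 addrK.
rewrite in_itv /= in tI.
by apply: hull_seg => //; apply: hull_point; rewrite !inE eqxx ?orbT.
Qed.

Lemma hull_pair_sub A i j : i != j -> i \in A -> j \in A ->
  hull p [set i; j]%SET `<=` hull p A.
Proof.
move=> ij iA jA x /(hull_pair _ ij)[t /=]; rewrite in_itv /= => tI <-.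
by apply: hull_seg => //; exact: hull_point.
Qed.

Lemma hull_interior_pair i j x : i != j ->
  hull_interior p [set i; j]%SET x <->
  exists2 t, 0 < t < 1 & x = seg (p i) (p j) t.
Proof.
move=> ij; split=> [[w [w0 w1 ->]]|[t /andP[t0 t1] ->]].
  rewrite !big_setU1 ?inE //= !big_set1 in w1 *.
  exists (w j); first by rewrite w0 ?inE ?eqxx ?orbT //=
    -w1 ltrDr w0 ?inE ?eqxx.
  by rewrite /seg -w1 addrK.
exists (fun k => if k == i then 1 - t else t); split.
- by move=> k _; case: ifP => _ //; rewrite subr_gt0.
- by rewrite big_setU1 ?inE //= big_set1 eqxx eq_sym (negPf ij) subrK.
- by rewrite big_setU1 ?inE //= big_set1 eqxx (eq_sym j) (negPf ij).
Qed.

Lemma hull_interiorW A : hull_interior p A `<=` hull p A.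
Proof. by move=> x [w [w0 w1 ->]]; exists w; split => // i /w0/ltW. Qed.

Lemma orient_hull i j x : i != j -> hull p [set i; j]%SET x ->
  orient (p i) (p j) x = 0.
Proof.
move=> ij /(hull_pair _ ij)[t _ <-].
by rewrite orient_seg (orient_refl _ _).1 (orient_refl _ _).2 !mulr0 addr0.
Qed.

(** Along a segment [orient] is affine, and each fraction is the parameter of its zero; both sides
    are the intersection point of the lines [ab] and [cd]. *)
Lemma seg_orient_root (a b c d : plane R) :
    orient a b c != orient a b d ->
  seg a b (orient c d a / (orient c d a - orient c d b)) =
  seg c d (orient a b c / (orient a b c - orient a b d)).
Proof.
move=> h; have h1 : orient a b c - orient a b d != 0 by rewrite subr_eq0.
have h2 : orient c d a - orient c d b != 0.
  suff -> : orient c d a - orient c d b = - (orient a b c - orient a b d).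
    by rewrite oppr_eq0.
  by rewrite /orient; ring.
case: a b c d h h1 h2 => [a1 a2] [b1 b2] [c1 c2] [d1 d2] _.
rewrite /seg /orient /= => h1 h2.
by congr pair; rewrite /= /GRing.scale /=; field; rewrite h1 h2.
Qed.

Lemma frac_itv (a b : R) : (a < 0 < b) || (b < 0 < a) -> 0 < a / (a - b) < 1.
Proof.
case/orP => /andP[h1 h2].
  rewrite -[a in a / _]opprK -[a - b]opprK opprB mulNr invrN mulrN opprK.
  have h : 0 < b - a by lra.
  by rewrite divr_gt0 ?oppr_gt0 //= ltr_pdivrMr // mul1r; lra.
have h : 0 < a - b by lra.
by rewrite divr_gt0 //= ltr_pdivrMr // mul1r; lra.
Qed.

Lemma chord_cross_orient i j k l : chord_cross i j k l =
  (orient (p i) (p j) (p k) < 0 < orient (p i) (p j) (p l)) ||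
  (orient (p i) (p j) (p l) < 0 < orient (p i) (p j) (p k)).
Proof. by rewrite !orient_lt0 !orient_gt0. Qed.

(** The pairs must differ, since a segment meets itself in its interior while [chord_cross i j i j]
    is false. *)
Lemma cross_pairs i j k l : i != j -> k != l ->
    [set i; j]%SET != [set k; l]%SET ->
  cross p [set i; j]%SET [set k; l]%SET <-> chord_cross i j k l.
Proof.
move=> ij kl ne; split=> [[x [xij xkl]]|h].
  have o0 := orient_hull ij (hull_interiorW xij).
  case/(hull_interior_pair _ kl): xkl => t /andP[t0 t1] xE.
  move: o0; rewrite xE orient_seg => o0.
  rewrite chord_cross_orient.
  have [ok|ok|ok] := ltrgtP (orient (p i) (p j) (p k)) 0.
  - by apply/orP; left; apply/andP; split => //; nra.
  - by apply/orP; right; apply/andP; split => //; nra.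
  - exfalso; rewrite ok mulr0 add0r in o0.
    have ol : orient (p i) (p j) (p l) = 0.
      by move/eqP: o0; rewrite mulf_eq0 gt_eqF //= => /eqP.
    case: (orient_eq0 ij ok) (orient_eq0 ij ol) => ki [] lj;
      by move: ne kl; rewrite ki lj ?(finset.setUC [set j]%SET) eqxx.
have h1 := h; rewrite chord_cross_orient in h1.
have h2 : chord_cross k l i j by rewrite chord_crossC.
rewrite chord_cross_orient in h2.
(* The intersection of the two lines; its parameters lie strictly between 0 and 1 because the
   endpoints have opposite orientations. *)
exists (seg (p i) (p j) (orient (p k) (p l) (p i) /
  (orient (p k) (p l) (p i) - orient (p k) (p l) (p j)))); split.
  by apply/(hull_interior_pair _ ij); eexists; first exact: (frac_itv h2).
apply/(hull_interior_pair _ kl); eexists; first exact: (frac_itv h1).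
apply: seg_orient_root; apply/eqP => E; move: h1; rewrite E.
by rewrite orbb => /andP[ha hb]; move: (lt_trans ha hb); rewrite ltxx.
Qed.

(** At [x] a convex combination of the orientations of [k] and [l] with respect to [ij] vanishes.
    Strictly opposite signs would be a crossing, so one of the two points is on the line [ij] and
    hence is [i] or [j]. *)
Lemma hulls_disjoint i j k l x : i != j -> k != l -> ~~ chord_cross i j k l ->
    hull p [set i; j]%SET x -> hull p [set k; l]%SET x ->
  exists2 w, w \in [set i; j]%SET & w \in [set k; l]%SET.
Proof.
move=> ij kl nx xij /(hull_pair _ kl)[t /=]; rewrite in_itv /= => /andP[t0 t1] xE.
have o0 := orient_hull ij xij; rewrite -xE orient_seg in o0.
have [ok|ok|ok] := ltrgtP (orient (p i) (p j) (p k)) 0; last first.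
- exists k; last by rewrite !inE eqxx.
  by case: (orient_eq0 ij ok) => ->; rewrite !inE eqxx ?orbT.
- have [ol|ol|ol] := ltrgtP (orient (p i) (p j) (p l)) 0; last first.
  + exists l; last by rewrite !inE eqxx orbT.
    by case: (orient_eq0 ij ol) => ->; rewrite !inE eqxx ?orbT.
  + by nra.
  + by case/negP: nx; rewrite chord_cross_orient ok ol orbT.
- have [ol|ol|ol] := ltrgtP (orient (p i) (p j) (p l)) 0; last first.
  + exists l; last by rewrite !inE eqxx orbT.
    by case: (orient_eq0 ij ol) => ->; rewrite !inE eqxx ?orbT.
  + by case/negP: nx; rewrite chord_cross_orient ok ol.
  + by nra.
Qed.

End Chords.

(** * Cells of a dissection as closures of convex regions *)

Section Cells.
Variables (R : realType) (n : nat) (p : 'I_(n.*2) -> plane R).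
Hypotheses (hn : (2 <= n)%N) (hcw : clockwise p).
Hypothesis hcircle : forall i, on_unit_circle (p i).
Local Notation pt := 'I_(n.*2).
Implicit Types (i j k l : pt) (V A d e : {set pt}) (D : {set {set pt}}).

Lemma exists_third i j : exists k, k \notin [set i; j]%SET.
Proof.
have : (0 < #|~: [set i; j]%SET|)%N.
  have := cardsC [set i; j]%SET; rewrite card_ord cards2; lia.
by case/card_gt0P => k; rewrite inE; exists k.
Qed.

Lemma point_neq i j : i != j ->
  0 < ((p j).1 - (p i).1) ^+ 2 + ((p j).2 - (p i).2) ^+ 2.
Proof.
move=> ij; have [k] := exists_third i j; rewrite !inE negb_or => /andP[ki kj].
have := orient_neq0 hcw ij ki kj; rewrite /orient => o.
rewrite lt_def addr_ge0 ?sqr_ge0 // andbT.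
apply: contra o; rewrite paddr_eq0 ?sqr_ge0 // !sqrf_eq0.
by case/andP => /eqP-> /eqP->; rewrite !mul0r subrr.
Qed.

Lemma dot_le (a b c d : R) : a ^+ 2 + b ^+ 2 = 1 ->
  a * c + b * d <= (1 + (c ^+ 2 + d ^+ 2)) / 2.
Proof. by have := sqr_ge0 (a - c); have := sqr_ge0 (b - d); lra. Qed.

(** The scalar product of [x] with each [p i] is at most [(1 + |x|^2) / 2]; averaging with the
    weights of [x] gives [|x|^2 <= (1 + |x|^2) / 2]. *)
Lemma hull_norm V x : hull p V x -> x.1 ^+ 2 + x.2 ^+ 2 <= 1 :> R.
Proof.
move=> [w [w0 w1 xE]]; pose f (y : plane R) : R := y.1 * x.1 + y.2 * x.2.
have fD y z : f (y + z) = f y + f z by rewrite /f /=; ring.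
have f0 : f 0 = 0 by rewrite /f /=; ring.
have fx : f x = \sum_(i in V) w i * f (p i).
  rewrite [in LHS]xE (big_morph f fD f0); apply: eq_bigr => i _.
  by rewrite /f /= /GRing.scale /=; ring.
have le i : f (p i) <= (1 + (x.1 ^+ 2 + x.2 ^+ 2)) / 2.
  exact: dot_le (hcircle i).
have : f x <= (1 + (x.1 ^+ 2 + x.2 ^+ 2)) / 2.
  move: le; set b := _ / 2 => le.
  rewrite fx (@le_trans _ _ (\sum_(i in V) w i * b)) //.
    by apply: ler_sum => i iV; apply: ler_wpM2l; rewrite ?w0.
  by rewrite -mulr_suml w1 mul1r.
by rewrite /f -!expr2; lra.
Qed.

(* A line through two points of the circle meets the disc in a chord. *)
Lemma hull_line V i j x : i != j -> hull p V x -> orient (p i) (p j) x = 0 ->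
  hull p [set i; j]%SET x.
Proof.
move=> ij /hull_norm; have q := point_neq ij.
have := hcircle i; have := hcircle j; rewrite /on_unit_circle /orient.
move=> hj hi hx o0; apply/(hull_pair _ _ ij).
case: x hx o0 => x1 x2 /=.
case: (p i) (p j) hi hj q => [a1 a2] [b1 b2] /= hi hj q hx o0.
set Q := _ + _ in q.
(* The parameter of the orthogonal projection of [x] to the line; [x] is its own projection because
   its orientation is zero. *)
pose t := ((x1 - a1) * (b1 - a1) + (x2 - a2) * (b2 - a2)) / Q.
have Q0 : Q != 0 by rewrite gt_eqF.
have tQ : t * Q = (x1 - a1) * (b1 - a1) + (x2 - a2) * (b2 - a2).
  by rewrite /t divfK.
have e1 : x1 = a1 + t * (b1 - a1).
  apply: (mulIf Q0); rewrite mulrDl mulrAC tQ /Q.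
  have -> : x1 * ((b1 - a1) ^+ 2 + (b2 - a2) ^+ 2) =
    a1 * ((b1 - a1) ^+ 2 + (b2 - a2) ^+ 2) +
    ((x1 - a1) * (b1 - a1) + (x2 - a2) * (b2 - a2)) * (b1 - a1) -
    (b2 - a2) * ((b1 - a1) * (x2 - a2) - (b2 - a2) * (x1 - a1)) by ring.
  by rewrite o0 mulr0 subr0.
have e2 : x2 = a2 + t * (b2 - a2).
  apply: (mulIf Q0); rewrite mulrDl mulrAC tQ /Q.
  have -> : x2 * ((b1 - a1) ^+ 2 + (b2 - a2) ^+ 2) =
    a2 * ((b1 - a1) ^+ 2 + (b2 - a2) ^+ 2) +
    ((x1 - a1) * (b1 - a1) + (x2 - a2) * (b2 - a2)) * (b2 - a2) +
    (b1 - a1) * ((b1 - a1) * (x2 - a2) - (b2 - a2) * (x1 - a1)) by ring.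
  by rewrite o0 mulr0 addr0.
(* The power of the point [x]: [t (1 - t) Q = 1 - |x|^2]. *)
have tt : 0 <= t * (1 - t).
  rewrite -(pmulr_lge0 _ q).
  have -> : t * (1 - t) * Q = (1 - t) * (a1 ^+ 2 + a2 ^+ 2) +
     t * (b1 ^+ 2 + b2 ^+ 2) - (x1 ^+ 2 + x2 ^+ 2).
    by rewrite e1 e2 /Q; ring.
  by rewrite hi hj; lra.
exists t; first by rewrite /= in_itv /=; apply/andP; split; nra.
by rewrite /seg e1 e2; congr pair; rewrite /= /GRing.scale /=; ring.
Qed.

Definition region V D (z : plane R) : set (plane R) :=
  hull p V `&` [set y | forall i j, i != j -> [set i; j]%SET \in D ->
    0 < orient (p i) (p j) z * orient (p i) (p j) y].

Definition chords V D := forall d, d \in D ->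
  exists i j, [/\ i != j, i \in V, j \in V & d = [set i; j]%SET].

Lemma polygon_minus_orient V D i j y : polygon_minus p V D y -> i != j ->
  [set i; j]%SET \in D -> orient (p i) (p j) y != 0.
Proof.
move=> [yV yD] ij ijD; apply/eqP => o0; apply: yD.
by exists [set i; j]%SET => //; exact: hull_line yV o0.
Qed.

Lemma region_refl V D z : polygon_minus p V D z -> region V D z z.
Proof.
move=> zP; split; first by case: zP.
move=> i j ij ijD; have := polygon_minus_orient zP ij ijD.
by rewrite -expr2 exprn_even_gt0.
Qed.

Lemma region_sub V D z : chords V D -> region V D z `<=` polygon_minus p V D.
Proof.
move=> hD y [yV yD]; split => // -[d dD yd].
have [i [j [ij _ _ dE]]] := hD _ dD; rewrite dE in dD yd.
by have := yD _ _ ij dD; rewrite (orient_hull ij yd) mulr0 ltxx.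
Qed.

Lemma conv_gt0 (t a b : R) : 0 <= t <= 1 -> 0 < a -> 0 < b ->
  0 < (1 - t) * a + t * b.
Proof.
case/andP => t0; rewrite le_eqVlt => /orP[/eqP->|t1] a0 b0.
  by rewrite subrr mul0r add0r mul1r.
by rewrite ltr_pwDl ?mulr_gt0 ?mulr_ge0 ?subr_gt0 // ltW.
Qed.

Lemma region_seg V D z x y (t : R) : region V D z x -> region V D z y ->
  0 <= t <= 1 -> region V D z (seg x y t).
Proof.
move=> [xV xD] [yV yD] tI; split; first exact: hull_seg.
move=> i j ij ijD; rewrite orient_seg.
rewrite mulrDr (mulrCA _ (1 - t)) (mulrCA _ t).
by apply: conv_gt0 => //; [exact: xD|exact: yD].
Qed.

(** Off the diagonals no orientation vanishes, so none changes sign on a connected set through [z].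
    Conversely the region is convex, and the segment from [z] stays in it. *)
Lemma component_region V D z : chords V D -> polygon_minus p V D z ->
  connected_component (polygon_minus p V D) z = region V D z.
Proof.
move=> hD zP; have zr := region_refl zP; apply/seteqP; split=> y.
  move=> [B [Bz BP Bc] By]; split; first by case: (BP _ By).
  move=> i j ij ijD.
  apply: (@connected_pos _ (fun y => orient (p i) (p j) z * orient (p i) (p j) y)
    B z _ Bc Bz _ _ y By) => [w||w /BP wP].
  - by apply: cvgM; [exact: cvg_cst|exact: orient_continuous].
  - exact: zr.2.
  - by rewrite mulf_neq0 //; exact: (@polygon_minus_orient V D).
move=> yr; exists (seg z y @` `[0, 1]).
  split; last exact: seg_connected.
    by exists 0; rewrite ?seg0 //= in_itv /= lexx ler01.
  move=> x [t /=]; rewrite in_itv /= => tI <-; apply: (region_sub hD (z := z)).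
  exact: region_seg.
by exists 1; rewrite ?seg1 //= in_itv /= lexx ler01.
Qed.

Lemma cell_region V D (C : set (plane R)) : chords V D ->
  cell p V D C <-> exists2 z, polygon_minus p V D z & C = closure (region V D z).
Proof.
by move=> hD; split => -[z zP ->]; exists z; rewrite // component_region.
Qed.

Lemma closure_region_ge0 V D z y i j : closure (region V D z) y -> i != j ->
  [set i; j]%SET \in D -> 0 <= orient (p i) (p j) z * orient (p i) (p j) y.
Proof.
move=> yc ij ijD; pose f w := orient (p i) (p j) z * orient (p i) (p j) w.
have fc : continuous f.
  by move=> w; apply: cvgM; [exact: cvg_cst|exact: orient_continuous].
have cl : closed [set w | 0 <= f w].
  by apply: (@closed_comp _ _ f [set w | 0 <= w]) => //; exact: closed_ge.
suff : closure [set w | 0 <= f w] y by rewrite -(closure_id _).1.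
by apply: closure_subset yc => w [_ /(_ i j ij ijD)/ltW].
Qed.

(** Moved slightly towards [z], the point [y] enters the region: weak inequalities at [y] and strict
    ones at [z] give strict ones in between. *)
Lemma closure_regionI V D z y : polygon_minus p V D z -> hull p V y ->
    (forall i j, i != j -> [set i; j]%SET \in D ->
      0 <= orient (p i) (p j) z * orient (p i) (p j) y) ->
  closure (region V D z) y.
Proof.
move=> zP yV yD B; rewrite -(seg0 y z) => /(@seg_continuous _ y z 0).
case/nbhs_ballP => eps /= eps0 sub.
pose t : R := Num.min 1 (eps / 2).
have t0 : 0 < t by rewrite lt_min ltr01 divr_gt0.
have t1 : t <= 1 by rewrite ge_min lexx.
exists (seg y z t); split; last first.
  apply: sub; rewrite /ball /= sub0r normrN gtr0_norm //.
  by rewrite gt_min ltr_pdivrMr ?mulr_natr ?mulr2n ?ltrDl // eps0 orbT.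
have zr := region_refl zP; split; first by apply: hull_seg; rewrite ?t1 ?ltW //; case: zP.
move=> i j ij ijD; rewrite orient_seg.
have yy := yD i j ij ijD; have zz := zr.2 i j ij ijD.
rewrite mulrDr (mulrCA _ (1 - t)) (mulrCA _ t).
apply: ltr_wpDl; last exact: mulr_gt0.
by apply: mulr_ge0; rewrite // subr_ge0.
Qed.

End Cells.

(** * From the cell description of signs to zigzags *)

Section Turns.
Variables (R : realType) (n : nat) (p : 'I_(n.*2) -> plane R).
Hypotheses (hn : (2 <= n)%N) (hcw : clockwise p).
Hypothesis hcircle : forall i, on_unit_circle (p i).
Local Notation pt := 'I_(n.*2).
Implicit Types (i j k l u v w x y a b : pt) (V A d e r s : {set pt}).
Implicit Types (D : {set {set pt}}) (c : bool).

Lemma polygon_diagonal_pair V d : polygon_diagonal V d ->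
  exists i j, [/\ i != j, i \in V, j \in V & d = [set i; j]%SET].
Proof.
case/andP => dV /cards2P[i [j [ij dE]]]; exists i, j; split => //;
  by apply: (fintype.subsetP dV); rewrite dE !inE eqxx ?orbT.
Qed.

Lemma dissection_chords V D : dissection p V D -> chords V D.
Proof. by move=> [h _] d /h /andP[/polygon_diagonal_pair]. Qed.

Lemma overline_chords V D : dissection p V D -> chords V (overline V D).
Proof.
move=> hD d; rewrite inE => /orP[/(dissection_chords hD)//|].
by rewrite inE => /andP[/polygon_diagonal_pair].
Qed.

Lemma pair_eq i j k l : i != j -> [set i; j]%SET = [set k; l]%SET ->
  (i = k /\ j = l) \/ (i = l /\ j = k).
Proof.
move=> ij E; have := set21 i j; have := set22 i j.
rewrite E !inE => /orP[]/eqP jE /orP[]/eqP iE; subst; rewrite ?eqxx // in ij.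
  by right.
by left.
Qed.

(** The only label strictly between [i] and [j] is even, so no hollow point is cut off by this
    edge. *)
Lemma boundary_noncross i j k l : i \in hollow -> k \in hollow ->
  l \in hollow -> (j == i + 2 %[mod n.*2])%N -> ~~ chord_cross i j k l.
Proof.
rewrite !inE /= => oi ok ol; rewrite (modn_small (ltn_ord j)).
have := ltn_ord i; have := ltn_ord k; have := ltn_ord l.
have [lt|ge] := ltnP (i + 2) n.*2.
  rewrite (modn_small lt) => _ _ _ /eqP jE.
  by rewrite /chord_cross /cyc; lia.
(* The edge through the end of the labelling, with [j = 0]. *)
move=> hl hk hi; have -> : (i + 2 = n.*2)%N by lia.
by rewrite modnn => /eqP jE; rewrite /chord_cross /cyc; lia.
Qed.

Lemma chord_cross_pair_eq i j k l : i != j -> [set i; j]%SET = [set k; l]%SET ->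
  ~~ chord_cross i j k l.
Proof.
by move=> ij /(pair_eq ij)[] [-> ->]; rewrite /chord_cross /cyc; lia.
Qed.

Lemma overline_noncross D i j k l : dissection p hollow D -> i != j -> k != l ->
    [set i; j]%SET \in overline hollow D ->
    [set k; l]%SET \in overline hollow D ->
  ~~ chord_cross i j k l.
Proof.
move=> hD ij kl; have hC := overline_chords hD.
have bd i' j' k' l' : i' != j' -> k' != l' -> boundary_edge hollow [set i'; j']%SET ->
    [set k'; l']%SET \in overline hollow D -> ~~ chord_cross i' j' k' l'.
  move=> ij' kl' /andP[/polygon_diagonal_pair [i1 [j1 [n1 hi1 hj1 E1]]]].
  case/existsP => i2 /existsP[j2 /andP[/eqP E2 m2]] /hC[k1 [l1 [nk hk hl Ek]]].
  have hI z : z \in [set i'; j']%SET -> z \in hollow.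
    by rewrite E1 !inE => /orP[]/eqP->; move: hi1 hj1; rewrite !inE.
  have hK z : z \in [set k'; l']%SET -> z \in hollow.
    by rewrite Ek !inE => /orP[]/eqP->; move: hk hl; rewrite !inE.
  have ik := hK _ (set21 _ _); have il := hK _ (set22 _ _).
  have ii := hI _ (set21 _ _); have jj := hI _ (set22 _ _).
  case: (pair_eq ij' E2) => -[iE jE]; subst.
    exact: boundary_noncross.
  by rewrite chord_cross_swapl; exact: boundary_noncross.
rewrite inE => /orP[ijD|]; last by rewrite inE => h1 h2; exact: bd.
rewrite inE => /orP[klD|]; last first.
  by rewrite inE chord_crossC => h1; apply: bd => //; rewrite inE ijD.
have [E|ne] := eqVneq [set i; j]%SET [set k; l]%SET.
  exact: chord_cross_pair_eq.
apply/negP => /(cross_pairs hcw ij kl ne); exact: hD.2.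
Qed.

Lemma solid_hollow x i : x \in solid -> i \in hollow -> x != i.
Proof. by rewrite !inE => h1 h2; apply/eqP => E; rewrite E h2 in h1. Qed.

Lemma cross_solid_hollow x y i j : x != y -> x \in solid -> i != j ->
    i \in hollow -> j \in hollow ->
  cross p [set x; y]%SET [set i; j]%SET <-> chord_cross x y i j.
Proof.
move=> xy xs ij ih jh; apply: cross_pairs => //; apply/eqP => /(pair_eq xy).
by case=> -[/eqP E _]; move: E; apply/negP; exact: solid_hollow.
Qed.

Lemma orient_onside c i j k :
  onside c i j k = (0 < (-1) ^+ c * orient (p i) (p j) (p k)).
Proof.
case: c => /=; rewrite ?expr1 ?expr0 ?mul1r ?mulN1r.
  by rewrite oppr_gt0 orient_lt0.
by rewrite orient_gt0.
Qed.

Lemma orient_wside c i j k : wside c i j k ->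
  0 <= (-1) ^+ c * orient (p i) (p j) (p k).
Proof.
rewrite /wside => /or3P[/eqP/val_inj->|/eqP/val_inj->|].
- by rewrite (orient_refl _ _).1 mulr0.
- by rewrite (orient_refl _ _).2 mulr0.
- by rewrite orient_onside => /ltW.
Qed.

Definition side c : plane R -> plane R -> plane R -> Prop :=
  if c then @right_of R else @left_of R.

Lemma side_onside c i j k : side c (p i) (p j) (p k) <-> onside c i j k.
Proof. by case: c; rewrite /side /right_of /left_of /= ?orient_lt0 ?orient_gt0. Qed.

(** The sign condition without cells: [c = true] stands for sign 1 and [c = false] for sign -1, and
    [au], [vb] may be any crossed segments on opposite sides of [r]. *)
Definition zigzag D c r e : Prop :=
  cross p e r /\ exists u v a b,
    [/\ r = [set u; v]%SET,
        [set a; u]%SET \in overline hollow D /\ cross p e [set a; u]%SET,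
        [set v; b]%SET \in overline hollow D /\ cross p e [set v; b]%SET,
        onside c u v a & onside (~~ c) u v b].

Lemma sign_mul_gt0 c (a b : R) : 0 < (-1) ^+ c * a -> 0 < (-1) ^+ c * b ->
  0 < a * b.
Proof.
by case: c => /=; rewrite ?expr1 ?expr0 ?mul1r ?mulN1r => ha hb; nra.
Qed.

Lemma sign_mul_ge0 c (a b : R) : 0 < (-1) ^+ c * a -> 0 <= (-1) ^+ c * b ->
  0 <= a * b.
Proof. by case: c => /=; rewrite ?expr1 ?expr0 ?mul1r ?mulN1r => ha hb; nra. Qed.

Lemma same_sign_mul_gt0 (z1 z2 a b : R) : z1 != 0 -> z2 != 0 -> 0 < a * b ->
  0 <= z1 * a -> 0 <= z2 * b -> 0 < z1 * z2.
Proof.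
move=> z10 z20 ab h1 h2; rewrite lt_def mulf_neq0 //=.
have: 0 <= (z1 * z2) * (a * b) by rewrite mulrACA mulr_ge0.
by rewrite pmulr_lge0.
Qed.

Lemma region_eq V D z1 z2 :
    (forall i j, i != j -> [set i; j]%SET \in D ->
      0 < orient (p i) (p j) z1 * orient (p i) (p j) z2) ->
  region p V D z1 = region p V D z2.
Proof.
move=> h; apply/seteqP; split=> y [yV yD]; split=> // i j ij ijD;
  move: (h i j ij ijD) (yD i j ij ijD) => h1 h2.
  have : 0 < (orient (p i) (p j) z1) ^+ 2 * (orient (p i) (p j) z2 * orient (p i) (p j) y).
    by rewrite expr2 mulrACA mulr_gt0.
  by rewrite pmulr_rgt0 // exprn_even_gt0 //=; apply: contraTneq h1 => ->; rewrite mul0r ltxx.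
have : 0 < (orient (p i) (p j) z2) ^+ 2 * (orient (p i) (p j) z1 * orient (p i) (p j) y).
  by rewrite expr2 mulrACA mulr_gt0 // mulrC.
by rewrite pmulr_rgt0 // exprn_even_gt0 //=; apply: contraTneq h1 => ->; rewrite mulr0 ltxx.
Qed.

(** What needs proof is that [b] is not on the side of [a]. If it were, the two cells would lie on
    the same side of [r] and of every other diagonal, so they would coincide. *)
Lemma turns_zigzag D c r e : dissection p hollow D -> r \in D ->
  turns p (side c) hollow D r e -> zigzag D c r e.
Proof.
move=> hD rD [er [C1 [C2 [u [v [a [b]]]]]]].
have hC := dissection_chords hD.
move=> [[/(cell_region hn hcw hcircle _ hC)[z1 z1P C1E] rC1]].
move=> [/(cell_region hn hcw hcircle _ hC)[z2 z2P C2E] rC2] C12 rE.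
move=> [[au _ auC1 eau] [vb vbr vbC2 evb] /side_onside sa].
split=> //; exists u, v, a, b; split=> //.
have [uv au' av] := onside_uniq sa.
have bv : b != v.
  have [i [j [ij _ _ E]]] := overline_chords hD vb.
  by have := cards2 v b; rewrite E cards2 ij (eq_sym b); case: (v != b).
have bu : b != u.
  by apply: contraNneq vbr => ->; rewrite rE finset.setUC.
apply: onside_total => //; apply/negP => sb; apply: C12; rewrite C1E C2E.
congr closure; apply: region_eq => i j ij ijD.
suff [a' [b' [a'C b'C ab]]] : exists a' b', [/\ C1 (p a'), C2 (p b') &
   0 < orient (p i) (p j) (p a') * orient (p i) (p j) (p b')].
  apply: same_sign_mul_gt0 ab _ _.
  - exact: (polygon_minus_orient hn hcw hcircle z1P).
  - exact: (polygon_minus_orient hn hcw hcircle z2P).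
  - by apply: (closure_region_ge0 (V := hollow) (D := D)); rewrite -?C1E.
  - by apply: (closure_region_ge0 (V := hollow) (D := D)); rewrite -?C2E.
have inC w : w \in r -> C1 (p w) /\ C2 (p w).
  by move=> wr; split; [apply: rC1|apply: rC2]; exact: hull_point.
have [E|ne] := eqVneq [set i; j]%SET r.
  exists a, b; split.
  - by apply: auC1; apply: hull_point; exact: set21.
  - by apply: vbC2; apply: hull_point; exact: set22.
  rewrite rE in E; case: (pair_eq ij E) => -[-> ->].
    by apply: (@sign_mul_gt0 c); rewrite -orient_onside.
  by apply: (@sign_mul_gt0 (~~ c)); rewrite -orient_onside onside_swap negbK.
(* For a diagonal other than [r], an endpoint of [r] off that diagonal belongs to both cells and
   fixes their common side. *)
suff [w wr wij] : exists2 w, w \in r & w \notin [set i; j]%SET.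
  exists w, w; have [w1 w2] := inC w wr; split => //.
  move: wij; rewrite !inE negb_or -expr2 => /andP[wi wj].
  by rewrite exprn_even_gt0 //= orient_neq0.
have [uij|] := boolP (u \in [set i; j]%SET); last first.
  by exists u => //; rewrite rE set21.
have [vij|] := boolP (v \in [set i; j]%SET); last first.
  by exists v => //; rewrite rE set22.
case/eqP: ne; rewrite rE; apply/eqP; rewrite eq_sym eqEcard !cards2 uv ij leqnn andbT.
by apply/fintype.subsetP => w /set2P[] ->.
Qed.

End Turns.

(** * From zigzags back to the two cells along a diagonal *)

Section ZigzagTurns.
Variables (R : realType) (n : nat) (p : 'I_(n.*2) -> plane R).
Hypotheses (hn : (2 <= n)%N) (hcw : clockwise p).
Hypothesis hcircle : forall i, on_unit_circle (p i).
Local Notation pt := 'I_(n.*2).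
Implicit Types (i j k l u v w x y a b : pt) (V A d e r s : {set pt}).
Implicit Types (D : {set {set pt}}) (c : bool).

Lemma overline_pair D i j : dissection p hollow D ->
  [set i; j]%SET \in overline hollow D -> [/\ i != j, i \in hollow & j \in hollow].
Proof.
move=> hD /(overline_chords hD)[k [l [kl hk hl E]]]; split.
- by have := cards2 i j; rewrite E cards2 kl; case: (i != j).
- by have := set21 i j; rewrite E => /set2P[] ->.
- by have := set22 i j; rewrite E => /set2P[] ->.
Qed.

(* Among the [au] crossed by [e] on the given side, the one closest to [v] bounds
   with [uv] a triangle that no diagonal of [D] enters. *)
Lemma closest_triangle D c x y u v a : dissection p hollow D ->
    [set u; v]%SET \in D -> [set a; u]%SET \in overline hollow D ->
    chord_cross x y u v -> chord_cross x y u a -> onside c u v a ->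
  exists a', [/\ [set a'; u]%SET \in overline hollow D, chord_cross x y u a',
    onside c u v a' & forall i j, i != j -> [set i; j]%SET \in D ->
      exists c', [&& wside c' i j u, wside c' i j v & wside c' i j a']].
Proof.
move=> hD uvD auD xuv xau sa.
pose P a := [&& [set a; u]%SET \in overline hollow D, chord_cross x y u a
  & onside c u v a].
pose btw a := [set w : pt | onside c u v w && onside c u w a]%SET.
have Pa : P a by rewrite /P auD xau sa.
case: (arg_minnP (fun a => #|btw a|) Pa) => a' /and3P[a'uD xa'u sa'] amin.
exists a'; split => // i j ij ijD.
have ijD' : [set i; j]%SET \in overline hollow D by rewrite inE ijD.
have uvD' : [set u; v]%SET \in overline hollow D by rewrite inE uvD.
have [uv _ _] := onside_uniq sa'.
have [a'u _ _] := overline_pair hD a'uD.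
have n1 := overline_noncross hn hcw hD ij uv ijD' uvD'.
have n2 := overline_noncross hn hcw hD ij a'u ijD' a'uD.
rewrite chord_cross_swapr in n2.
(* The remaining case is a diagonal [uw] inside the angle at [u]. It is crossed too, and fewer
   points lie between [v] and [w] than between [v] and [a'], against the choice of [a']. *)
have [//|[w0 [E sw swa]]] := triangle_separation ij sa' n1 n2.
have [w wE] : exists w : pt, w0 = w.
  by case/orP: E => /andP[/eqP E1 /eqP E2]; [exists j|exists i].
rewrite wE {w0 wE} in E sw swa.
have wuD : [set w; u]%SET \in overline hollow D.
  suff -> : [set w; u]%SET = [set i; j]%SET by [].
  by case/orP: E => /andP[/eqP/val_inj-> /eqP/val_inj->]; rewrite // finset.setUC.
have xw : chord_cross x y u w := fan_between xuv xa'u sw swa.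
have := amin w; rewrite /P wuD xw sw => /(_ isT); rewrite leqNgt.
case/negP; apply: proper_card; apply/properP; split.
  apply/fintype.subsetP => w'; rewrite !inE => /andP[-> /= h].
  exact: onside_trans swa.
exists w; rewrite !inE ?sw //=.
by apply/negP => /onside_uniq[_ _]; rewrite eqxx.
Qed.

Lemma hull_sub_cell V D z k l : polygon_minus p V D z -> k != l ->
    k \in V -> l \in V ->
    (forall i j w, i != j -> [set i; j]%SET \in D -> w \in [set k; l]%SET ->
      0 <= orient (p i) (p j) z * orient (p i) (p j) (p w)) ->
  hull p [set k; l]%SET `<=` closure (region p V D z).
Proof.
move=> zP kl kV lV h x xkl.
apply: (closure_regionI hn hcw hcircle) => //; first exact: hull_pair_sub xkl.
move=> i j ij ijD; case/(hull_pair _ _ kl): xkl => t /=.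
rewrite in_itv /= => /andP[t0 t1] <-.
rewrite orient_seg mulrDr (mulrCA _ (1 - t)) (mulrCA _ t).
by rewrite addr_ge0 // mulr_ge0 ?subr_ge0 ?h ?set21 ?set22.
Qed.

(** The cell is that of a point inside the triangle [uva]: each diagonal has the triangle weakly on
    one side, and this point strictly, as the three vertices are not all on its line. The last
    conclusion serves to tell apart the cells on the two sides of [uv]. *)
Lemma triangle_cell D c u v a : dissection p hollow D ->
    u \in hollow -> v \in hollow -> a \in hollow ->
    [set u; v]%SET \in D -> onside c u v a ->
    (forall i j, i != j -> [set i; j]%SET \in D ->
      exists c', [&& wside c' i j u, wside c' i j v & wside c' i j a]) ->
  exists C, [/\ cell p hollow D C, hull p [set u; v]%SET `<=` C,
    hull p [set a; u]%SET `<=` C &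
    forall w, C (p w) -> wside c u v w].
Proof.
move=> hD uh vh ah uvD sa sep; have hC := dissection_chords hD.
have [uv au av] := onside_uniq sa.
(* All three vertices have positive weight in [z]: 1/4, 1/4 and 1/2. *)
pose z := seg (seg (p u) (p v) (2^-1)) (p a) (2^-1).
have half : 0 <= (2^-1 : R) <= 1 by rewrite invr_ge0 ler0n invf_le1 ?ler1n ?ltr0n.
have zV : hull p hollow z by do 2?apply: hull_seg => //; exact: hull_point.
have zs i j : i != j -> [set i; j]%SET \in D ->
    exists c', 0 < (-1) ^+ c' * orient (p i) (p j) z /\
      [&& wside c' i j u, wside c' i j v & wside c' i j a].
  move=> ij ijD; have [c' hc'] := sep i j ij ijD; exists c'; split => //.
  case/and3P: hc' => /(orient_wside hcw) hu /(orient_wside hcw) hv /(orient_wside hcw) ha.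
  rewrite /z !orient_seg.
  suff : [|| orient (p i) (p j) (p u) != 0, orient (p i) (p j) (p v) != 0
     | orient (p i) (p j) (p a) != 0].
    move: hu hv ha.
    move: (orient _ _ (p u)) (orient _ _ (p v)) (orient _ _ (p a)) => ou ov oa.
    by case: (c'); rewrite /= ?expr0 ?expr1 => hu hv ha /or3P[];
      rewrite neq_lt => /orP[]; lra.
  apply: contraT; rewrite !negb_or !negbK => /and3P[/eqP eu /eqP ev /eqP ea].
  have := orient_eq0 hcw ij eu; have := orient_eq0 hcw ij ev.
  have := orient_eq0 hcw ij ea.
  by case=> e1 [] e2 [] e3; move: uv au av; rewrite e1 e2 e3 ?eqxx.
have zP : polygon_minus p hollow D z.
  split=> // -[d dD]; have [i [j [ij _ _ E]]] := hC _ dD.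
  rewrite E in dD * => zd; have [c' [+ _]] := zs i j ij dD.
  by rewrite (orient_hull ij zd) mulr0 ltxx.
have zw i j w : i != j -> [set i; j]%SET \in D -> w \in [set u; v; a]%SET ->
    0 <= orient (p i) (p j) z * orient (p i) (p j) (p w).
  move=> ij ijD; have [c' [h /and3P[hu hv ha]]] := zs i j ij ijD.
  rewrite !inE -orbA => /or3P[]/eqP->; apply: (sign_mul_ge0 h); exact: orient_wside.
exists (closure (region p hollow D z)); split.
- by apply/(cell_region hn hcw hcircle _ hC); exists z.
- apply: hull_sub_cell => // i j w ij ijD wuv; apply: zw => //.
  by move: wuv; rewrite !inE => ->.
- apply: hull_sub_cell => // i j w ij ijD wuv; apply: zw => //.
  by move: wuv; rewrite !inE => /orP[]->; rewrite ?orbT.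
move=> w wC; have := closure_region_ge0 wC uv uvD.
rewrite /wside; have [->|wu] := eqVneq w u; first by rewrite eqxx.
have [->|wv] := eqVneq w v; first by rewrite eqxx orbT.
rewrite (inj_eq val_inj) (negPf wu) (inj_eq val_inj) (negPf wv) /= => zw0.
apply: contraT => nw; have sw := onside_total uv wu wv nw.
have za := zw u v a uv uvD; rewrite !inE eqxx orbT in za.
have {}za := za isT.
have aw : 0 < orient (p u) (p v) (p a) * - orient (p u) (p v) (p w).
  apply: (@sign_mul_gt0 _ c); first by rewrite -orient_onside.
  rewrite mulrN -mulNr; have := sw; rewrite (orient_onside hcw).
  by case: (c); rewrite /= ?expr0 ?expr1 ?opprK.
have z0 := polygon_minus_orient hn hcw hcircle zP uv uvD.
have : 0 < orient (p u) (p v) z * orient (p u) (p v) z.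
  by rewrite -expr2 exprn_even_gt0.
by move: z0 za aw zw0; set oz := orient _ _ z; set oa := orient _ _ (p a);
  set ow := orient _ _ (p w) => z0 za aw zw0 zz; nra.
Qed.

(** Replacing [a] and [b] by the closest choices gives an uncut triangle on each side of [uv], hence
    the two cells; they differ because [a'] is strictly on the wrong side for the second. *)
Lemma zigzag_turns D c r e : dissection p hollow D -> r \in D ->
  polygon_diagonal solid e -> zigzag p D c r e -> turns p (side c) hollow D r e.
Proof.
move=> hD rD /polygon_diagonal_pair [x [y [xy xs ys eE]]].
move=> [er [u [v [a [b [rE [au eau] [vb evb] sa sb]]]]]].
split=> //; rewrite eE rE in er eau evb rD *.
have [uv _ _] := onside_uniq sa.
have uvD : [set u; v]%SET \in overline hollow D by rewrite inE rD.
have [_ uh vh] := overline_pair hD uvD.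
have [auN ah _] := overline_pair hD au.
have [vbN _ bh] := overline_pair hD vb.
move/(cross_solid_hollow hcw xy xs uv uh vh): er => er.
move/(cross_solid_hollow hcw xy xs auN ah uh): eau => eau.
move/(cross_solid_hollow hcw xy xs vbN vh bh): evb => evb.
rewrite chord_cross_swapr in eau.
have [a' [a'u xa' sa' sepa]] := closest_triangle hD rD au er eau sa.
have vuD : [set v; u]%SET \in D by rewrite finset.setUC.
have bv : [set b; v]%SET \in overline hollow D by rewrite finset.setUC.
have evu : chord_cross x y v u by rewrite chord_cross_swapr.
have sb' : onside c v u b by rewrite onside_swap.
have [b' [b'v xb' sb'' sepb]] := closest_triangle hD vuD bv evu evb sb'.
have [a'uN a'h _] := overline_pair hD a'u.
have [b'vN b'h _] := overline_pair hD b'v.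
have [C1 [C1c rC1 aC1 h1]] := triangle_cell hD uh vh a'h rD sa' sepa.
have [C2 [C2c rC2 bC2 h2]] := triangle_cell hD vh uh b'h vuD sb'' sepb.
rewrite (finset.setUC [set v]%SET) in rC2.
rewrite (finset.setUC [set b']%SET) in bC2.
exists C1, C2, u, v, a', b'; split => //.
  move=> E; have /h2 : C2 (p a') by rewrite -E; apply: aC1; apply: hull_point; rewrite set21.
  rewrite wside_swap /wside; have [_ /negPf n1 /negPf n2] := onside_uniq sa'.
  by rewrite n1 n2 /=; apply/negP; exact: onsideN.
have [_ /negPf a'u' /negPf a'v'] := onside_uniq sa'.
have [_ /negPf b'v' /negPf b'u'] := onside_uniq sb''.
split; last exact/side_onside.
  split => //.
    apply/eqP => /setP/(_ a'); rewrite !inE eqxx /=.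
    by rewrite -!(inj_eq val_inj) a'u' a'v'.
  by apply/(cross_solid_hollow hcw xy xs a'uN a'h uh); rewrite chord_cross_swapr.
split => //.
- by rewrite finset.setUC.
- apply/eqP => /setP/(_ b'); rewrite !inE eqxx orbT.
  by rewrite -!(inj_eq val_inj) b'u' b'v'.
- apply/(cross_solid_hollow hcw xy xs _ vh b'h) => //; by rewrite eq_sym.
Qed.

Lemma turnsE D c r e : dissection p hollow D -> r \in D ->
  polygon_diagonal solid e -> turns p (side c) hollow D r e <-> zigzag p D c r e.
Proof. by move=> hD rD he; split; [exact: turns_zigzag|exact: zigzag_turns]. Qed.

End ZigzagTurns.

(** * Connectedness of the crossed segments in combinatorial form *)

Section Accordions.
Variables (R : realType) (n : nat) (p : 'I_(n.*2) -> plane R).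
Hypotheses (hn : (2 <= n)%N) (hcw : clockwise p).
Local Notation pt := 'I_(n.*2).
Implicit Types (i j k l u v w a b : pt) (V A d e r s : {set pt}).
Implicit Types (D S X : {set {set pt}}) (c : bool).

Definition hulls S : set (plane R) := [set x | exists2 s, s \in S & hull p s x].

(* Connectedness, stated by cuts, of the graph on [S] whose edges join segments
   with a common endpoint. *)
Definition linked S : Prop := forall X, X \subset S -> X != finset.set0 -> X != S ->
  exists s s' w, [/\ s \in X, s' \in S, s' \notin X, w \in s & w \in s'].

Definition noncrossing S : Prop := forall i j k l, i != j -> k != l ->
  [set i; j]%SET \in S -> [set k; l]%SET \in S -> ~~ chord_cross i j k l.

Lemma hulls_closed V S : chords V S -> closed (hulls S).
Proof.
move=> hS; have -> : hulls S = \bigcup_(s in [set` S]) hull p s.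
  by apply/seteqP; split=> x [s sS xs]; exists s.
apply: closed_bigcup; first exact: finite_finset.
move=> s /= /hS[i [j [ij _ _ ->]]].
have -> : hull p [set i; j]%SET = seg (p i) (p j) @` `[0, 1].
  by apply/seteqP; split=> x /(hull_pair _ _ ij).
exact: seg_closed.
Qed.

Lemma hull_connected V S s : chords V S -> s \in S -> connected (hull p s).
Proof.
move=> hS /hS[i [j [ij _ _ ->]]].
have -> : hull p [set i; j]%SET = seg (p i) (p j) @` `[0, 1].
  by apply/seteqP; split=> x /(hull_pair _ _ ij).
exact: seg_connected.
Qed.

Lemma hulls_meet V S s s' x : chords V S -> noncrossing S ->
    s \in S -> s' \in S -> hull p s x -> hull p s' x ->
  exists2 w, w \in s & w \in s'.
Proof.
move=> hS nS sS s'S; have [i [j [ij _ _ sE]]] := hS _ sS.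
have [k [l [kl _ _ s'E]]] := hS _ s'S; rewrite {}sE {}s'E in sS s'S *.
by apply: hulls_disjoint => //; exact: nS.
Qed.

Lemma chords_sub V S X : X \subset S -> chords V S -> chords V X.
Proof. by move=> XS hS d /(fintype.subsetP XS)/hS. Qed.

(** Non-crossing segments meet only in common endpoints, so a cut without such an endpoint would
    split the union into two disjoint nonempty closed sets. *)
Lemma linked_hulls V S : chords V S -> noncrossing S -> connected (hulls S) ->
  linked S.
Proof.
move=> hS nS cS X XS X0 XnS; apply: contrapT => nlink.
have sep s s' : s \in X -> s' \in S -> s' \notin X ->
    forall x, hull p s x -> hull p s' x -> False.
  move=> sX s'S s'X x xs xs'; apply: nlink.
  have [w ws ws'] := hulls_meet hS nS (fintype.subsetP XS _ sX) s'S xs xs'.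
  by exists s, s', w.
have hull_ne s : s \in S -> exists x, hull p s x.
  by case/hS => i [j [ij _ _ ->]]; exists (p i); apply: hull_point; rewrite set21.
have E : hulls X = hulls S.
  apply: cS.
  - case/set0Pn: X0 => s sX; have [x xs] := hull_ne _ (fintype.subsetP XS _ sX).
    by exists x, s.
  - exists (~` hulls (S :\: X)%SET).
      by apply: closed_openC; apply: (hulls_closed (chords_sub (subsetDl S X) hS)).
    apply/seteqP; split=> x.
      move=> [s sX xs]; split; first by exists s => //; exact: (fintype.subsetP XS).
      by move=> [s']; rewrite inE => /andP[s'X s'S] xs'; exact: (sep s s' sX s'S s'X x).
    move=> [[s sS xs] nx]; exists s => //; apply: contraT => sX.
    by case: nx; exists s => //; rewrite inE sX.
  - exists (hulls X); first exact: (hulls_closed (chords_sub XS hS)).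
    apply/seteqP; split=> x; last by case.
    by move=> xX; split => //; case: xX => s /(fintype.subsetP XS) sS xs; exists s.
have /subsetPn[s' s'S s'X] : ~~ (S \subset X).
  by apply: contra XnS => SX; rewrite finset.eqEsubset XS.
have [x xs'] := hull_ne _ s'S.
have [s sX xs] : hulls X x by rewrite E; exists s'.
exact: (sep s s' sX s'S s'X x).
Qed.

(** A part open and closed in the union contains every segment that it meets. If the segments inside
    it were not all of [S], a link would join one of them to a segment outside. *)
Lemma hulls_linked V S : chords V S -> linked S -> connected (hulls S).
Proof.
move=> hS lS B [x Bx] [U Uo BU] [F Fc BF].
have BS : B `<=` hulls S by rewrite BU => y [].
have whole s : s \in S -> (exists2 y, hull p s y & B y) -> hull p s `<=` B.
  move=> sS [y ys By].
  have sSS : hull p s `<=` hulls S by move=> z zs; exists s.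
  suff E : hull p s `&` B = hull p s by rewrite -E => z [].
  apply: (hull_connected hS sS); first by exists y.
  - by exists U => //; apply/seteqP; split=> z [zs]; rewrite BU;
      [case|split => //; split => //; exact: sSS].
  - by exists F => //; apply/seteqP; split=> z [zs]; rewrite BF;
      [case|split => //; split => //; exact: sSS].
pose X := [set s in S | `[< hull p s `<=` B >]]%SET.
have XS : X \subset S by apply/fintype.subsetP => s; rewrite inE => /andP[].
have [XE|XnS] := eqVneq X S.
  apply/seteqP; split => // y [s sS ys].
  by move: sS; rewrite -XE inE => /andP[_ /asboolP]; exact.
have X0 : X != finset.set0.
  have [s sS xs] := BS _ Bx; apply/set0Pn; exists s; rewrite inE sS /=.
  by apply/asboolP; apply: whole => //; exists x.
have [s [s' [w [sX s'S s'X ws ws']]]] := lS X XS X0 XnS.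
case/negP: s'X; rewrite inE s'S; apply/asboolP; apply: whole => //.
exists (p w); first exact: hull_point.
by move: sX; rewrite inE => /andP[_ /asboolP]; apply; exact: hull_point.
Qed.

Definition crossed D e : {set {set pt}} :=
  [set s in overline hollow D | `[< cross p e s >]]%SET.

Lemma mem_crossed D e s :
  s \in crossed D e <-> s \in overline hollow D /\ cross p e s.
Proof. by rewrite inE; split=> [/andP[-> /asboolP]|[-> /asboolP]]. Qed.

Lemma accordion_linked D e : dissection p hollow D ->
  accordion_diagonal p D e <-> polygon_diagonal solid e /\ linked (crossed D e).
Proof.
move=> hD; have -> : linked (crossed D e) <-> connected (hulls (crossed D e)).
  have cs : crossed D e \subset overline hollow D.
    by apply/fintype.subsetP => s /mem_crossed[].
  have hC := chords_sub cs (overline_chords hD).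
  split; first exact: (hulls_linked hC).
  apply: (linked_hulls hC) => i j k l ij kl /mem_crossed[h1 _] /mem_crossed[h2 _].
  exact: (overline_noncross hn hcw hD).
suff -> : hulls (crossed D e) =
    [set x | exists2 s, s \in overline hollow D /\ cross p e s & hull p s x] by [].
by apply/seteqP; split=> x [s /mem_crossed h xs]; exists s.
Qed.

Lemma overline_mem D s w : dissection p hollow D -> s \in overline hollow D ->
  w \in s -> exists b, [/\ s = [set w; b]%SET, w != b, w \in hollow & b \in hollow].
Proof.
move=> hD /(overline_chords hD)[i [j [ij ih jh ->]]] /set2P[] ->.
  by exists j.
by exists i; rewrite finset.setUC eq_sym.
Qed.

Lemma overlineS D D' : D \subset D' -> overline hollow D \subset overline hollow D'.
Proof. exact: finset.setSU. Qed.

(** The edge joins the two neighbours of [x]. Every solid diagonal at [x] crosses it, and it stays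
    on the side of [x] of any hollow chord; so an accordion diagonal crosses a boundary edge near
    each of its ends. *)
Lemma solid_edge (x : pt) : x \in solid ->
  exists i j, [/\ i != j, i \in hollow, j \in hollow,
    boundary_edge hollow [set i; j]%SET &
    (forall y, y \in solid -> x != y -> chord_cross x y i j) /\
    (forall c u v, u \in hollow -> v \in hollow -> onside c u v x ->
      wside c u v i && wside c u v j)].
Proof.
rewrite inE /= negbK => xo; have xn := ltn_ord x.
have x0 : (0 < x)%N by case: (x : nat) xo.
have i_lt : (x.-1 < n.*2)%N by lia.
pose i : pt := Ordinal i_lt.
(* The successor of the last point is the ordinal 0. *)
have [j jE] : exists j : pt, (j = x.+1 :> nat) \/ (j = 0 :> nat /\ x.+1 = n.*2)%N.
  have [h|h] := ltnP x.+1 n.*2; first by exists (Ordinal h); left.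
  have h0 : (0 < n.*2)%N by lia.
  by exists (Ordinal h0); right; split => //=; lia.
have ih : i \in hollow by rewrite inE /=; lia.
have jh : j \in hollow by rewrite inE /=; lia.
have iE : i = x.-1 :> nat by [].
have ij : i != j by apply/eqP => /(congr1 val) /=; lia.
exists i, j; split => //.
- rewrite /boundary_edge /polygon_diagonal cards2 ij eqxx andbT.
  apply/andP; split; first by apply/fintype.subsetP => w /set2P[] ->.
  apply/existsP; exists i; apply/existsP; exists j; rewrite eqxx /=.
  case: jE => [->|[-> xE]].
    by rewrite ?iE addn2 prednK.
  by rewrite ?iE addn2 prednK // xE modnn mod0n.
- split=> [y|c u v].
    rewrite inE /= negbK => yo /eqP xy; have yn := ltn_ord y.
    have {}xy : (x : nat) <> y by move=> /val_inj.
    by clear ij ih jh; rewrite /chord_cross /cyc; lia.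
  rewrite !inE /= => uo vo; have un := ltn_ord u; have vn := ltn_ord v.
  by clear ij ih jh; case: c; rewrite /wside /onside /cyc; lia.
Qed.

(** Cut the crossed segments of [D] into those on side [c] of [uv], with [uv] itself left out, and
    the others. The link across this cut has its common endpoint on both sides of [uv], hence at [u]
    or [v]. The diagonal [uv] is only assumed to be in [D']. *)
Lemma accordion_fan D D' e u v c :
    dissection p hollow D -> dissection p hollow D' -> D \subset D' ->
    polygon_diagonal solid e -> linked (crossed D e) ->
    [set u; v]%SET \in D' -> cross p e [set u; v]%SET ->
  exists w b s', [/\ w \in [set u; v]%SET, [set w; b]%SET \in crossed D e,
    onside c u v b, s' \in crossed D e & w \in s' /\
    (s' = [set u; v]%SET \/
     exists2 b', s' = [set w; b']%SET & onside (~~ c) u v b')].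
Proof.
move=> hD hD' DD' /polygon_diagonal_pair[x [y [xy xs ys eE]]] lD uvD'.
have [uvint _] := hD'; have /andP[_ uvnb] := uvint _ uvD'.
have uvO : [set u; v]%SET \in overline hollow D' by rewrite inE uvD'.
have [uv uh vh] := overline_pair hD' uvO.
rewrite {1}eE => /(cross_solid_hollow hcw xy xs uv uh vh) euv.
have crossedP i j : [set i; j]%SET \in overline hollow D -> chord_cross x y i j ->
    [set i; j]%SET \in crossed D e.
  move=> ijO xc; apply/mem_crossed; split => //; rewrite eE.
  by have [ij ih jh] := overline_pair hD ijO; apply/cross_solid_hollow.
have wsideE w : wside c u v w -> wside (~~ c) u v w -> w \in [set u; v]%SET.
  move=> h1 h2; have [] : (w = u :> nat) \/ (w = v :> nat).
    by apply: wside_both; case: (c) h1 h2.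
    by move=> /val_inj->; rewrite set21.
  by move=> /val_inj->; rewrite set22.
pose X := [set s in crossed D e | (s != [set u; v]) &&
  (s \subset [set w : pt | wside c u v w])]%SET.
(* The boundary edge at an end of [e] shows that there are crossed segments on either side of
   [uv]. *)
have ends (z z' : pt) : z \in solid -> z' \in solid -> z != z' ->
    (forall i j, chord_cross z z' i j = chord_cross x y i j) ->
    forall c', onside c' u v z ->
    exists2 s, s \in crossed D e & (s != [set u; v]%SET) &&
      (s \subset [set w : pt | wside c' u v w])%SET.
  move=> zs z's zz' cE c' sz; have [i [j [ij ih jh bij [h1 h2]]]] := solid_edge zs.
  exists [set i; j]%SET.
    apply: crossedP; first by rewrite inE; apply/orP; right; rewrite inE.
    by rewrite -cE; exact: h1.
  apply/andP; split; first by apply: contraNneq uvnb => <-.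
  have /andP[iw jw] := h2 c' u v uh vh sz.
  by apply/fintype.subsetP => w /set2P[] ->; rewrite inE.
have [s1 s1c s1X] : exists2 s, s \in crossed D e & (s != [set u; v]%SET) &&
      (s \subset [set w : pt | wside c u v w])%SET.
  have [[h _]|[h _]] := chord_cross_side c euv; first exact: (ends x y).
  by apply: (ends y x) => // [|i j]; rewrite 1?eq_sym // chord_cross_swapl.
have [s2 s2c /andP[s2r s2w]] : exists2 s, s \in crossed D e & (s != [set u; v]%SET) &&
      (s \subset [set w : pt | wside (~~ c) u v w])%SET.
  have [[_ h]|[_ h]] := chord_cross_side c euv; last exact: (ends x y).
  by apply: (ends y x) => // [|i j]; rewrite 1?eq_sym // chord_cross_swapl.
have crossedO s : s \in crossed D e -> s \in overline hollow D.
  by case/mem_crossed.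
have XS : X \subset crossed D e by apply/fintype.subsetP => s; rewrite inE => /andP[].
have X0 : X != finset.set0 by apply/set0Pn; exists s1; rewrite inE s1c.
have XnS : X != crossed D e.
  (* Otherwise [s2] would be on both sides of [uv], hence equal to it. *)
  apply/eqP => E; move: (s2c); rewrite -E inE => /and3P[_ _ s2w'].
  case/negP: s2r; rewrite eqEcard.
  have [i [j [ij _ _ s2E]]] := overline_chords hD (crossedO _ s2c).
  rewrite {2}s2E !cards2 uv ij leqnn andbT; apply/fintype.subsetP => w ws.
  have := fintype.subsetP s2w w ws; have := fintype.subsetP s2w' w ws.
  by rewrite !inE => h1 h2; have := wsideE w h1 h2; rewrite !inE.
have [s [s' [w [sX s'S s'X ws ws']]]] := lD X XS X0 XnS.
move: sX; rewrite inE => /and3P[sS sr sw].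
(* A segment with a vertex strictly on the other side stays there, since it does not cross [uv]. *)
have s'cases : s' = [set u; v]%SET \/ (s' != [set u; v]%SET /\
    forall w', w' \in s' -> wside (~~ c) u v w').
  have [->|s'r] := eqVneq s' [set u; v]%SET; [by left|right; split => //].
  move: s'X; rewrite inE s'S s'r /= => /subsetPn[k ks' kw].
  have [l [s'E kl kh lh]] := overline_mem hD (crossedO _ s'S) ks'.
  have kside : onside (~~ c) u v k.
    move: kw; rewrite inE /wside !negb_or => /and3P[ku kv kc].
    exact: onside_total.
  have klO : [set k; l]%SET \in overline hollow D'.
    by rewrite -s'E; apply: (fintype.subsetP (overlineS DD')); exact: crossedO.
  have nc := overline_noncross hn hcw hD' uv kl uvO klO.
  move=> w'; rewrite s'E => /set2P[] ->; last exact: noncross_wside nc kside.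
  by rewrite /wside kside !orbT.
have wuv : w \in [set u; v]%SET.
  case: s'cases => [<- //|[_ h]]; apply: wsideE; last exact: h.
  by have := fintype.subsetP sw w ws; rewrite inE.
have other t c' : t \in overline hollow D -> t != [set u; v]%SET -> w \in t ->
    (forall w', w' \in t -> wside c' u v w') ->
    exists2 b, t = [set w; b]%SET & onside c' u v b.
  move=> tO tr wt tw; have [b [tE wb _ _]] := overline_mem hD tO wt.
  exists b => //; have := tw b; rewrite tE set22 => /(_ isT).
  rewrite /wside => /or3P[/eqP/val_inj E|/eqP/val_inj E|//];
    case/negP: tr; rewrite tE; case/set2P: wuv wb => ->; rewrite E ?eqxx //.
  by rewrite finset.setUC eqxx.
have [b sE sb] : exists2 b, s = [set w; b]%SET & onside c u v b.
  apply: other => //; first exact: crossedO.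
  by move=> w' /(fintype.subsetP sw); rewrite inE.
exists w, b, s'; split; rewrite -?sE //; split => //.
case: s'cases => [|[s'r h]]; [by left|right].
by apply: other => //; exact: crossedO.
Qed.

End Accordions.

(** * Adding and removing diagonals of the hollow dissection *)

Section Refinement.
Variables (R : realType) (n : nat) (p : 'I_(n.*2) -> plane R).
Hypotheses (hn : (2 <= n)%N) (hcw : clockwise p).
Local Notation pt := 'I_(n.*2).
Implicit Types (i j k l u v w x y a b : pt) (V A d e r s : {set pt}).
Implicit Types (D S X E : {set {set pt}}) (c : bool).

Lemma dissection_sub V D D' : D \subset D' -> dissection p V D' -> dissection p V D.
Proof.
move=> /fintype.subsetP DD' [h1 h2]; split=> [d /DD' /h1 //|d d' /DD' dD /DD'].
exact: h2.
Qed.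

Lemma crossed_pair D x y i j : dissection p hollow D -> x != y -> x \in solid ->
  [set i; j]%SET \in crossed p D [set x; y]%SET ->
  [set i; j]%SET \in overline hollow D /\ chord_cross x y i j.
Proof.
move=> hD xy xs /mem_crossed[ijO h]; split => //.
by have [ij ih jh] := overline_pair hD ijO; apply/(cross_solid_hollow hcw).
Qed.

Lemma crossed_sub D D' e : D \subset D' -> crossed p D e \subset crossed p D' e.
Proof.
move=> DD'; apply/fintype.subsetP => s /mem_crossed[sO es].
by apply/mem_crossed; split => //; apply: (fintype.subsetP (overlineS DD')).
Qed.

Lemma crossed_fan_conflict D e c u v a b : dissection p hollow D ->
    polygon_diagonal solid e ->
    [set u; v]%SET \in crossed p D e -> [set u; a]%SET \in crossed p D e ->
    [set v; b]%SET \in crossed p D e ->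
    onside c u v a -> onside c u v b ->
  False.
Proof.
move=> hD /polygon_diagonal_pair[x [y [xy xs ys ->]]] h1 h2 h3 sa sb.
have [uvO xuv] := crossed_pair hD xy xs h1.
have [uaO xua] := crossed_pair hD xy xs h2.
have [vbO xvb] := crossed_pair hD xy xs h3.
have [ua _ _] := overline_pair hD uaO; have [vb _ _] := overline_pair hD vbO.
have /negP := overline_noncross hn hcw hD ua vb uaO vbO; apply.
exact: (fan_conflict xuv xua xvb sa sb).
Qed.

Lemma crossed_new D D' e s : s \in crossed p D' e -> s \notin crossed p D e ->
  s \in D' /\ s \notin D.
Proof.
move=> /mem_crossed[sO es] ns.
have nO : s \notin overline hollow D.
  by apply: contra ns => sD; apply/mem_crossed.
move: sO nO; rewrite !inE negb_or => /orP[sD'|->]; last by rewrite andbF.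
by case/andP.
Qed.

(** By [accordion_fan] every new crossed diagonal shares an endpoint with an old crossed segment. A
    cut therefore either cuts the old segments, or has them all on one side and is linked through
    such an endpoint. *)
Lemma linked_refine D D' e : dissection p hollow D -> dissection p hollow D' ->
    D \subset D' -> polygon_diagonal solid e -> linked (crossed p D e) ->
  linked (crossed p D' e).
Proof.
move=> hD hD' DD' he lD X XS X0 XnS.
have SS' := crossed_sub e DD'.
have attach s : s \in crossed p D' e -> s \notin crossed p D e ->
    exists t w, [/\ t \in crossed p D e, w \in s & w \in t].
  move=> sS' sS; have [sD' _] := crossed_new sS' sS.
  have [u [v [uv uh vh sE]]] := dissection_chords hD' sD'.
  have es : cross p e s by case/mem_crossed: sS'.
  rewrite {}sE in es sD' *.
  have [w [b [s' [wuv wb _ _ _]]]] := accordion_fan hn hcw true hD hD' DD' he lD sD' es.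
  by exists [set w; b]%SET, w; rewrite set21.
have [XS0|XS0] := eqVneq (X :&: crossed p D e)%SET finset.set0.
  case/set0Pn: X0 => s sX.
  have disj t : t \in crossed p D e -> t \notin X.
    by move=> tS; apply/negP => tX; have := finset.in_set0 t; rewrite -XS0 finset.in_setI tX tS.
  have sS : s \notin crossed p D e by apply/negP => /disj; rewrite sX.
  have [t [w [tS ws wt]]] := attach s (fintype.subsetP XS _ sX) sS.
  exists s, t, w; split => //; [exact: (fintype.subsetP SS')|exact: disj].
have [XSS|XSS] := eqVneq (X :&: crossed p D e)%SET (crossed p D e).
  have /subsetPn[s sS' sX] : ~~ (crossed p D' e \subset X).
    by apply: contra XnS => h; rewrite finset.eqEsubset XS.
  have sub t : t \in crossed p D e -> t \in X.
    by rewrite -XSS inE => /andP[].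
  have sS : s \notin crossed p D e by apply: contra sX => /sub.
  have [t [w [tS ws wt]]] := attach s sS' sS.
  by exists t, s, w; split => //; exact: sub.
have [s [s' [w [sX s'S s'X ws ws']]]] := lD _ (subsetIr _ _) XS0 XSS.
exists s, s', w; split => //.
- by move: sX; rewrite inE => /andP[].
- exact: (fintype.subsetP SS').
- by move: s'X; rewrite inE s'S andbT.
Qed.

Lemma zigzag_refine D D' c r e : D \subset D' ->
  zigzag p D c r e -> zigzag p D' c r e.
Proof.
move=> /overlineS/fintype.subsetP DD' [er [u [v [a [b [rE [h1 h2] [h3 h4] sa sb]]]]]].
by split=> //; exists u, v, a, b; split => //; split => //; exact: DD'.
Qed.

Lemma zigzag_crossed D r e c : dissection p hollow D -> r \in D ->
  zigzag p D c r e -> exists u v a b, [/\ r = [set u; v]%SET,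
    [set u; v]%SET \in crossed p D e, [set u; a]%SET \in crossed p D e,
    [set v; b]%SET \in crossed p D e & onside c u v a /\ onside (~~ c) u v b].
Proof.
move=> hD rD [er [u [v [a [b [rE h1 h3 sa sb]]]]]]; exists u, v, a, b.
split=> //; apply/mem_crossed; rewrite -?rE ?(finset.setUC [set u]%SET) //.
by rewrite inE rD.
Qed.

(** [accordion_fan] yields a segment of [D] on each side of [r]. By [crossed_fan_conflict] the one
    on the side of [a] must start at [u] and the one on the side of [b] at [v], so they form a
    zigzag. *)
Lemma zigzag_coarsen D D' c r e :
    dissection p hollow D -> dissection p hollow D' -> D \subset D' ->
    polygon_diagonal solid e -> linked (crossed p D e) -> r \in D' ->
  zigzag p D' c r e -> r \in D /\ zigzag p D c r e.
Proof.
move=> hD hD' DD' he lD rD' zz.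
have [u [v [a [b [rE uvS uaS vbS [sa sb]]]]]] := zigzag_crossed hD' rD' zz.
have [_ er] := (mem_crossed p D' e _).1 uvS.
rewrite rE in rD'.
have up s : s \in crossed p D e -> s \in crossed p D' e.
  exact: (fintype.subsetP (crossed_sub e DD')).
have vuS : [set v; u]%SET \in crossed p D' e by rewrite finset.setUC.
have nov b' c' : [set v; b']%SET \in crossed p D e -> onside c' u v b' ->
    onside c' u v a -> False.
  by move=> /up vb' sb'; move/(crossed_fan_conflict hD' he uvS uaS vb'); apply.
have nou b' c' : [set u; b']%SET \in crossed p D e -> onside c' u v b' ->
    onside c' u v b -> False.
  by move=> /up ub' sb'; apply: (crossed_fan_conflict hD' he uvS ub' vbS sb').
have [w [a' [s' [wuv wa' sa' s'S [ws' s'E]]]]] :=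
  accordion_fan hn hcw c hD hD' DD' he lD rD' er.
have wu : w = u.
  by case/set2P: wuv wa' => -> // va'; case: (nov _ _ va' sa' sa).
rewrite {w wuv}wu in wa' ws' s'E.
have [w2 [b' [s2' [wuv2 wb' sb' _ _]]]] :=
  accordion_fan hn hcw (~~ c) hD hD' DD' he lD rD' er.
have wv : w2 = v.
  by case/set2P: wuv2 wb' => -> // va'; case: (nou _ _ va' sb' sb).
rewrite {w2 wuv2}wv in wb'.
split.
  (* Were [r] not in [D], the link across it would be a segment from [u] to the side of [b], in
     conflict with [vb]. *)
  case: s'E => [s'E|[b2 s'E sb2]]; last first.
    by rewrite s'E in s'S; case: (nou _ _ s'S sb2 sb).
  move: s'S; rewrite s'E -rE => /mem_crossed[+ _].
  rewrite inE => /orP[//|]; rewrite inE => bd.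
  by have /andP[_ /negP] := hD'.1 _ rD'; rewrite -rE.
split; first by rewrite rE.
exists u, v, a', b'; split => //; last exact/mem_crossed.
by rewrite finset.setUC; exact/mem_crossed.
Qed.

(** Without a zigzag, the segments that [accordion_fan] gives on the two sides of [r] start at the
    same endpoint [w], so the connection through [r] can be replaced by one at [w]. *)
Lemma linked_setD1 D r e : dissection p hollow D -> polygon_diagonal solid e ->
    r \in D -> linked (crossed p D e) -> (forall c, ~ zigzag p D c r e) ->
  linked (crossed p (D :\ r)%SET e).
Proof.
move=> hD he rD lD nz.
have DD' : (D :\ r)%SET \subset D by rewrite finset.subD1set.
have SE s : (s \in crossed p (D :\ r)%SET e) = (s != r) && (s \in crossed p D e).
  have /andP[_ rb] := hD.1 _ rD.
  rewrite !inE; have [->|//] := eqVneq s r.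
  by rewrite (negPf rb).
have [rS|rS] := boolP (r \in crossed p D e); last first.
  suff -> : crossed p (D :\ r)%SET e = crossed p D e by [].
  apply/setP => s; rewrite SE; have [->|//] := eqVneq s r.
  by rewrite (negPf rS).
have [u [v [uv uh vh rE]]] := dissection_chords hD rD.
have [_ er] := (mem_crossed p D e _).1 rS; rewrite {}rE in rD rS er nz DD' SE *.
have fan c := accordion_fan hn hcw c hD hD (subxx D) he lD rD er.
have [w1 [b1 [_ [w1uv wb1 sb1 _ _]]]] := fan true.
have [w2 [b2 [_ [w2uv wb2 sb2 _ _]]]] := fan false.
have zz c u' v' a b : [set u; v]%SET = [set u'; v']%SET ->
    [set u'; a]%SET \in crossed p D e -> [set v'; b]%SET \in crossed p D e ->
    onside c u' v' a -> onside (~~ c) u' v' b -> False.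
  move=> E /mem_crossed ua /mem_crossed vb sa sb; apply: (nz c); split => //.
  by exists u', v', a, b; split => //; rewrite finset.setUC.
have {w2uv} w12 : w2 = w1.
  case/set2P: w1uv wb1 => -> wb1; case/set2P: w2uv wb2 => -> wb2 //.
    by case: (zz true u v b1 b2).
  by case: (zz false v u b1 b2) => //; rewrite finset.setUC.
rewrite {w2}w12 in wb2.
pose w := w1; pose tb c := if c then b1 else b2.
have tS c : [set w; tb c]%SET \in crossed p D e by case: c.
have ts c : onside c u v (tb c) by case: c.
have tS' c : [set w; tb c]%SET \in crossed p (D :\ [set u; v])%SET e.
  rewrite SE tS andbT; apply/eqP => /setP/(_ (tb c)); rewrite !inE eqxx orbT.
  have [_ + +] := onside_uniq (ts c).
  by rewrite !(inj_eq val_inj) => /negPf-> /negPf->.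
move=> X XS X0 XnS; apply: contrapT => nlink.
have nl s s' z : s \in X -> s' \in crossed p (D :\ [set u; v])%SET e ->
    s' \notin X -> z \in s -> z \in s' -> False.
  by move=> h1 h2 h3 h4 h5; apply: nlink; exists s, s', z.
(* The two segments at [w] are on the same side of an unlinked cut, so [X] or its complement
   contains neither; call it [Y]. In [D] it can be linked only through [r]. *)
suff main (Y : {set {set pt}}) : Y \subset crossed p (D :\ [set u; v])%SET e -> Y != finset.set0 ->
    (forall c, [set w; tb c]%SET \notin Y) ->
    (forall s s' z, s \in Y -> s' \in crossed p (D :\ [set u; v])%SET e ->
      s' \notin Y -> z \in s -> z \in s' -> False) -> False.
  have [tX|tX] := boolP ([set w; tb true]%SET \in X); last first.
    apply: (main X) => // c; apply/negP => tcX.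
    by apply: (nl _ _ w tcX (tS' true) tX); rewrite set21.
  apply: (main (crossed p (D :\ [set u; v])%SET e :\: X)%SET).
  - exact: finset.subsetDl.
  - apply: contra XnS => /eqP E; rewrite finset.eqEsubset XS /=.
    by rewrite -finset.setD_eq0 E.
  - move=> c; rewrite inE tS' andbT negbK; apply: contraT => tcX.
    by case: (nl _ _ w tX (tS' c) tcX); rewrite set21.
  - move=> s s' z; rewrite !finset.in_setD => /andP[sX sS] s'S.
    by rewrite s'S andbT negbK => s'X zs zs'; exact: (nl s' s z).
move=> YS Y0 tY nY.
have YSD := fintype.subset_trans YS (crossed_sub e DD').
have rY : [set u; v]%SET \notin Y.
  by apply/negP => /(fintype.subsetP YS); rewrite SE eqxx.
have YnS : Y != crossed p D e by apply: contraNneq rY => ->.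
have [s [s' [z [sY s'S s'Y zs zs']]]] := lD Y YSD Y0 YnS.
have [s'E|s'r] := eqVneq s' [set u; v]%SET; last first.
  by apply: (nY s s' z) => //; rewrite SE s'r.
rewrite {s' s'S s'Y}s'E in zs'.
have sS := fintype.subsetP YSD _ sY.
have sr : s != [set u; v]%SET by apply: contraNneq rY => <-.
have [sO _] := (mem_crossed p D e _).1 sS.
have [b [sE zb zh bh]] := overline_mem hD sO zs.
have [bu bv] : b != u /\ b != v.
  by split; apply: contraNneq sr => bE; rewrite sE bE; case/set2P: zs' zb => ->;
    rewrite bE ?eqxx // finset.setUC.
have [c sb] : exists c, onside c u v b.
  have [h|h] := boolP (onside true u v b); first by exists true.
  by exists false; exact: (onside_total (c := true)).
have [zw|zw] := eqVneq z w.
  by apply: (nY s _ w sY (tS' c) (tY c)); rewrite ?set21 // -zw.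
(* Now segments leave both ends of [uv] towards the same side, which [crossed_fan_conflict]
   excludes. *)
have [zu|zv] : (z = u /\ w = v) \/ (z = v /\ w = u).
  case/set2P: zs' zw => ->; case/set2P: w1uv; rewrite -/w => ->; rewrite ?eqxx //;
    by [left|right].
  case: zu => zE wE; rewrite sE zE in sS; have tSc := tS c; rewrite wE in tSc.
  exact: (crossed_fan_conflict hD he rS sS tSc sb (ts c)).
case: zv => zE wE; rewrite sE zE in sS; have tSc := tS c; rewrite wE in tSc.
exact: (crossed_fan_conflict hD he rS tSc sS (ts c) sb).
Qed.

(** The extra diagonals are removed one at a time; by [zigzag_refine], a removal creates no zigzag
    at those that remain. *)
Lemma linked_coarsen D D' e : dissection p hollow D' -> D \subset D' ->
    polygon_diagonal solid e -> linked (crossed p D' e) ->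
    (forall r c, r \in D' -> r \notin D -> ~ zigzag p D' c r e) ->
  linked (crossed p D e).
Proof.
have [m] := ubnP #|D' :\: D|; elim: m D' => // m IH D' lem hD' DD' he lD' nz.
have [D'D|/subsetPn[r rD' rD]] := boolP (D' \subset D).
  suff -> : D = D' by [].
  by apply/eqP; rewrite finset.eqEsubset DD'.
have sub : (D' :\ r)%SET \subset D' by rewrite finset.subD1set.
apply: (IH (D' :\ r)%SET) => //.
- move: lem; rewrite (cardsD1 r (D' :\: D)%SET) inE rD rD' /= add1n ltnS.
  apply: leq_ltn_trans; apply: subset_leq_card; apply/fintype.subsetP => s.
  by rewrite !inE => /and3P[-> -> ->].
- exact: dissection_sub hD'.
- by rewrite finset.subsetD1 DD'.
- by apply: linked_setD1 => // c; exact: nz.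
- move=> r' c; rewrite inE => /andP[_ r'D'] r'D /(zigzag_refine sub); exact: nz.
Qed.

Lemma zigzag_coherent D r e e' : dissection p hollow D -> r \in D ->
    polygon_diagonal solid e -> polygon_diagonal solid e' -> e != e' ->
    zigzag p D true r e -> zigzag p D false r e' ->
  cross p e e'.
Proof.
move=> hD rD /polygon_diagonal_pair[x [y [xy xs ys ->]]].
move=> /polygon_diagonal_pair[x' [y' [xy' xs' ys' ->]]] ee'.
move=> /(zigzag_crossed hD rD)[u [v [a [b [rE uvS uaS vbS [sa sb]]]]]].
move=> /(zigzag_crossed hD rD)[u' [v' [d [c [rE' uvS' uaS' vbS' [sd sc]]]]]].
have [uv _ _] := onside_uniq sa.
apply/(cross_pairs hcw) => //.
have [uvO xuv] := crossed_pair hD xy xs uvS.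
have [uaO xua] := crossed_pair hD xy xs uaS.
have [vbO xvb] := crossed_pair hD xy xs vbS.
have [_ xuv'] := crossed_pair hD xy' xs' uvS'.
have [udO xud] := crossed_pair hD xy' xs' uaS'.
have [vcO xvc] := crossed_pair hD xy' xs' vbS'.
have nc i j k l : [set i; j]%SET \in overline hollow D ->
    [set k; l]%SET \in overline hollow D -> ~~ chord_cross i j k l.
  move=> h1 h2; have [ij _ _] := overline_pair hD h1.
  by have [kl _ _] := overline_pair hD h2; exact: (overline_noncross hn hcw hD).
(* The two zigzags may name the endpoints of [r] in opposite orders. *)
rewrite rE in rE'; case: (pair_eq uv rE') => -[uE vE]; subst u' v'.
  by apply: (zigzag_cross sa sb sc sd) => //; exact: nc.
rewrite chord_cross_swapr in xuv'.
by apply: (zigzag_cross sa sb sd sc) => //; exact: nc.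
Qed.

End Refinement.

(** * Signs, vectors and cones for a pair of nested dissections *)

Section Fans.
Variables (R : realType) (n : nat) (p : 'I_(n.*2) -> plane R).
Hypotheses (hn : (2 <= n)%N) (hcw : clockwise p).
Hypothesis hcircle : forall i, on_unit_circle (p i).
Local Notation pt := 'I_(n.*2).
Implicit Types (d e r : {set pt}) (D E : {set {set pt}}).

Lemma zetaE D r e : dissection p hollow D -> r \in D ->
    polygon_diagonal solid e ->
  zeta p hollow D r e = if `[< zigzag p D true r e >] then 1
    else if `[< zigzag p D false r e >] then -1 else 0.
Proof.
move=> hD rD he; have tE := fun c => asbool_equiv_eq (turnsE hn hcw hcircle c hD rD he).
by rewrite /zeta (tE true) (tE false).
Qed.

Lemma zeta_eq0 D r e : dissection p hollow D -> r \in D ->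
    polygon_diagonal solid e ->
  zeta p hollow D r e = 0 <-> forall c, ~ zigzag p D c r e.
Proof.
move=> hD rD he; rewrite zetaE //; split=> [|h].
  case: asboolP => [_ /eqP|nt]; first by rewrite oner_eq0.
  case: asboolP => [_ /eqP|nf _ []//]; by rewrite oppr_eq0 oner_eq0.
by rewrite !asboolF.
Qed.

Lemma zeta_coherent D r e e' : dissection p hollow D -> r \in D ->
    polygon_diagonal solid e -> polygon_diagonal solid e' ->
    (e != e' -> ~ cross p e e') ->
  0 < zeta p hollow D r e -> 0 <= zeta p hollow D r e'.
Proof.
move=> hD rD he he' ncr; rewrite !zetaE //.
have [zt _|nzt] := asboolP (zigzag p D true r e); last first.
  by case: asboolP => _; rewrite ?ltxx // oppr_gt0 ltNge ler01.
have [_|nt] := asboolP (zigzag p D true r e'); first exact: ler01.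
have [zf|//] := asboolP (zigzag p D false r e').
have [ee'|ee'] := eqVneq e e'; first by rewrite ee' in zt.
by case: (ncr ee'); exact: (zigzag_coherent hn hcw hD rD).
Qed.

Section Pair.
Variables D D' : {set {set pt}}.
Hypotheses (hD : dissection p hollow D) (hD' : dissection p hollow D').
Hypothesis hDD' : D \subset D'.

(** Zigzags at diagonals of [D] are the same for [D] and [D'], and [zigzag_coarsen] excludes them at
    the other diagonals of [D']. *)
Lemma gvector_embed e : accordion_diagonal p D e ->
  embed D' (gvector p D e) = gvector p D' e.
Proof.
move=> /(accordion_linked hn hcw _ hD)[he lD]; apply/ffunP => -[d dD'].
rewrite !ffunE /=; have [dD|dD] := boolP (d \in D).
  rewrite (insubT (fun d => d \in D) dD) /= ffunE /= !zetaE //.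
  have zE c : `[< zigzag p D c d e >] = `[< zigzag p D' c d e >].
    apply: asbool_equiv_eq; split; first exact: zigzag_refine.
    by case/(zigzag_coarsen hn hcw hD hD' hDD' he lD dD').
  by rewrite !zE.
rewrite insubN //=; apply/esym/zeta_eq0 => // c.
case/(zigzag_coarsen hn hcw hD hD' hDD' he lD dD') => dD1.
by rewrite dD1 in dD.
Qed.

Lemma accordion_refine e : accordion_diagonal p D e -> accordion_diagonal p D' e.
Proof.
move=> /(accordion_linked hn hcw _ hD)[he lD].
apply/(accordion_linked hn hcw _ hD'); split => //.
exact: (linked_refine hn hcw hD).
Qed.

Lemma accordion_coarsen e : accordion_diagonal p D' e ->
  coord_subspace D D' (gvector p D' e) -> accordion_diagonal p D e.
Proof.
move=> /(accordion_linked hn hcw _ hD')[he lD'] g0.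
apply/(accordion_linked hn hcw _ hD); split => //.
apply: (linked_coarsen hn hcw hD') => // r c rD' rD.
have := g0 (exist _ r rD') rD; rewrite ffunE /= => /zeta_eq0; exact.
Qed.

Lemma embed_coord_subspace (x : coords R D) : coord_subspace D D' (embed D' x).
Proof. by move=> d dD; rewrite ffunE insubN. Qed.

Lemma embed_sum E (c : {set pt} -> R) (g : {set pt} -> coords R D) :
  embed D' (\sum_(e in E) c e *: g e) = \sum_(e in E) c e *: embed D' (g e).
Proof.
apply/ffunP => d; rewrite ffunE !sum_ffunE.
case E0 : (insub (val d)) => [d0|] /=.
  by rewrite sum_ffunE; apply: eq_bigr => e _; rewrite !ffunE E0.
by rewrite big1 // => e _; rewrite !ffunE E0 scaler0.
Qed.

Lemma embed_gcone E : (forall e, e \in E -> accordion_diagonal p D e) ->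
  embed D' @` gcone p D E = gcone p D' E.
Proof.
move=> hE; apply/seteqP; split=> x.
  move=> [y [c c0 ->] <-]; exists c => //; rewrite embed_sum.
  by apply: eq_bigr => e eE; rewrite gvector_embed //; exact: hE.
move=> [c c0 ->]; exists (\sum_(e in E) c e *: gvector p D e).
  by exists c.
by rewrite embed_sum; apply: eq_bigr => e eE; rewrite gvector_embed //; exact: hE.
Qed.

Definition subspace_part E : {set {set pt}} :=
  [set e in E | `[< coord_subspace D D' (gvector p D' e) >]]%SET.

(** At a diagonal outside [D], a point of the subspace has coordinate zero. By sign-coherence this
    is a sum of terms of one sign, so each term vanishes and only rays in the subspace have nonzero
    coefficients. *)
Lemma gcone_section E : accordion_dissection p D' E ->
  gcone p D' E `&` coord_subspace D D' = gcone p D' (subspace_part E).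
Proof.
move=> [[Eint Enc] Eacc].
have Esolid e : e \in E -> polygon_diagonal solid e by move=> /Eint /andP[].
have sumE (c : {set pt} -> R) : (forall e, e \in E -> e \notin subspace_part E -> c e = 0) ->
    \sum_(e in E) c e *: gvector p D' e =
    \sum_(e in subspace_part E) c e *: gvector p D' e.
  move=> c0; rewrite big_mkcond [RHS]big_mkcond /=; apply: eq_bigr => e _.
  have [eP|eP] := boolP (e \in subspace_part E).
    by move: (eP); rewrite inE => /andP[-> _].
  by case: ifP => // eE; rewrite c0 // scale0r.
apply/seteqP; split=> x; last first.
  (* The coefficients are extended by zero, as [c] may be negative outside the subspace part. *)
  move=> [c c0 xE]; pose c' e := if e \in subspace_part E then c e else 0.
  have xE' : x = \sum_(e in subspace_part E) c' e *: gvector p D' e.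
    by rewrite xE; apply: eq_bigr => e eP; rewrite /c' eP.
  split.
    exists c'; first by move=> e _; rewrite /c'; case: ifP => // /c0.
    by rewrite xE' sumE // => e _ /negPf eP; rewrite /c' eP.
  move=> d dD; rewrite xE sum_ffunE big1 // => e; rewrite inE => /andP[_ /asboolP h].
  by rewrite ffunE h // scaler0.
move=> [[c c0 xE] xs]; exists c.
  by move=> e; rewrite inE => /andP[/c0].
rewrite xE; apply: sumE => e eE; rewrite inE eE /= => /asboolP ng.
apply: contrapT => /eqP ce; apply: ng => -[d dD'] dD; rewrite ffunE /=.
apply: contrapT => /eqP zne.
have xd : \sum_(e in E) c e * zeta p hollow D' d e = 0.
  have := xs (exist _ d dD') dD; rewrite xE sum_ffunE.
  by under eq_bigr do rewrite !ffunE.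
have coh e1 e2 : e1 \in E -> e2 \in E -> 0 < zeta p hollow D' d e1 ->
    0 <= zeta p hollow D' d e2.
  by move=> h1 h2; apply: zeta_coherent; rewrite ?Esolid // => h; exact: Enc.
suff : c e * zeta p hollow D' d e == 0 by rewrite mulf_eq0 (negPf ce) (negPf zne).
have [zpos|zneg] := ltP 0 (zeta p hollow D' d e).
  move/eqP: xd; rewrite psumr_eq0 => [/allP/(_ e)|e' e'E].
    by rewrite mem_index_enum eE => /(_ isT).
  by rewrite mulr_ge0 ?c0 // (coh e).
(* A positive sign elsewhere would, by coherence, make the nonzero sign at [e] positive as well. *)
have zneg' : forall e', e' \in E -> zeta p hollow D' d e' <= 0.
  move=> e' e'E; rewrite leNgt; apply/negP => /(coh e' e e'E eE) h.
  by case/eqP: zne; apply/eqP; rewrite eq_le zneg h.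
move/eqP: xd; rewrite -oppr_eq0 -sumrN psumr_eq0 => [/allP/(_ e)|e' e'E].
  by rewrite mem_index_enum eE oppr_eq0 => /(_ isT).
by rewrite -mulrN mulr_ge0 ?c0 // oppr_ge0 zneg'.
Qed.

Lemma accordion_dissection_subspace_part E : accordion_dissection p D' E ->
  accordion_dissection p D (subspace_part E).
Proof.
move=> [hE Eacc]; split.
  by apply: dissection_sub hE; apply/fintype.subsetP => e; rewrite inE => /andP[].
move=> e; rewrite inE => /andP[eE /asboolP ge].
by apply: accordion_coarsen ge; exact: Eacc.
Qed.

End Pair.
End Fans.

Theorem theorem4p4 (R : realType) (n : nat) (hn : (2 <= n)%N)
    (p : 'I_(n.*2) -> plane R)
    (hcircle : forall i, on_unit_circle (p i)) (hcw : clockwise p)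
    (D D' : {set {set 'I_(n.*2)}})
    (hD : dissection p hollow D) (hD' : dissection p hollow D')
    (hDD' : D \subset D') :
  [set embed D' @` C | C in gfan p D]
    = [set C : set (coords R D') | gfan p D' C /\ C `<=` coord_subspace D D']
  /\
  [set embed D' @` C | C in gfan p D]
    = [set C `&` coord_subspace D D' | C in gfan p D'].
Proof.
have sub : [set embed D' @` C | C in gfan p D] `<=`
    [set C : set (coords R D') | gfan p D' C /\ C `<=` coord_subspace D D'].
  move=> _ [_ [E [hE Eacc] ->] <-]; split; last first.
    by move=> _ [x _ <-]; exact: embed_coord_subspace.
  exists E; last exact: embed_gcone.
  by split => // e /Eacc; exact: accordion_refine.
(* With [sub] this closes a circle of inclusions: a cone inside the subspace is its own section, and
   every section is an embedded cone of the smaller fan. *)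
have sect E : accordion_dissection p D' E ->
    [set embed D' @` C | C in gfan p D] (gcone p D' E `&` coord_subspace D D').
  move=> hE; have hE' := accordion_dissection_subspace_part hn hcw hcircle hD hD' hDD' hE.
  rewrite gcone_section // -(embed_gcone hn hcw hcircle hD hD' hDD' hE'.2).
  by exists (gcone p D (subspace_part p D D' E)) => //; exists (subspace_part p D D' E).
split; apply/seteqP; split => // C.
- by move=> [[E hE ->] /setIidl <-]; exact: sect.
- by move=> /sub[gC /setIidl CE]; exists C.
- by move=> [_ [E hE ->] <-]; exact: sect.
Qed.
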